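(* There is a deterministic $O(\log k)$-competitive algorithm for the online (multi-source) rent-or-buy problem, where $k$ is the number of terminals that arrive online.
   Context: Setting: there is an underlying complete graph $G=(V,E)$ with edge lengths $d(u,v)$ such that $(V,d)$ is a finite metric space whose minimum edge length is $1$. The algorithm does not know $G$ initially; at each time step it only knows the submetric of $d$ induced on the terminals that have arrived so far. For a graph or edge set $H$, $c(H)$ denotes the sum of the lengths of its edges. Online rent-or-buy problem: the algorithm is given a real parameter $M\ge 0$ at the beginning and maintains a subgraph $H$ of bought edges. Terminal pairs $(s_i,t_i)$ arrive one by one. When $(s_i,t_i)$ arrives, the algorithm buys zero or more edges (adding them to $H$) and rents a set of edges $Q_i$ such that $H\cup Q_i$ connects $s_i$ and $t_i$. Decisions are irrevocable: edges cannot be removed from $H$ later, and $Q_i$ is fixed after the $i$-th step. The total cost is $M c(H)+\sum_i c(Q_i)$, where $H$ is the final bought subgraph. The terminals are the endpoints of the arriving pairs. Competitiveness: let $\mathrm{OPT}$ be the minimum of $Mc(H)+\sum_i c(Q_i)$ over all offline choices of a subgraph $H$ and edge sets $Q_i$ of $G$ such that $H\cup Q_i$ connects $s_i$ and $t_i$ for every $i$. A deterministic online algorithm is $O(\log k)$-competitive if there is an absolute constant $c$ (independent of $M$) such that on every instance with $k\ge 2$ terminals its cost is at most $c\cdot\log k\cdot\mathrm{OPT}$. *)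

(* Defs.v *)
From mathcomp Require Import all_boot all_order all_algebra.
From mathcomp Require Import reals exp.

Set Implicit Arguments.
Unset Strict Implicit.
Unset Printing Implicit Defensive.
Import Order.TTheory GRing.Theory Num.Theory.
Local Open Scope ring_scope.

Section Graph.
Variables (R : realType) (V : finType) (d : V -> V -> R).

Definition is_metric : Prop :=
  [/\ forall u v, (d u v = 0) <-> (u = v),
      forall u v, d u v = d v u
    & forall u v w, d u w <= d u v + d v w].

Definition min_edge_length_1 : Prop :=
  (forall u v, u != v -> 1 <= d u v) /\ (exists u v, u != v /\ d u v = 1).

Definition complete_edges : {set {set V}} := [set e : {set V} | #|e| == 2%N].

(* The length of {u, v} is its diameter; see [edge_lengthE]. *)
Definition edge_length (e : {set V}) : R :=
  \big[Num.max/0]_(u in e) \big[Num.max/0]_(v in e) d u v.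

Definition total_length (F : {set {set V}}) : R := \sum_(e in F) edge_length e.

Definition connects (F : {set {set V}}) (u v : V) : bool :=
  connect [rel x y | [set x; y] \in F] u v.

Lemma metric_ge0 : is_metric -> forall u v, 0 <= d u v.
Proof.
case=> d0 dC dT u v; have := dT u v u.
by rewrite (dC v u) ((d0 u u).2 erefl) -mulr2n pmulrn_lge0.
Qed.

Lemma edge_lengthE u v : is_metric -> edge_length [set u; v] = d u v.
Proof.
move=> dm; have d_ge0 := metric_ge0 dm; case: dm => d0 dC _.
apply/le_anti/andP; split.
  apply: bigmax_le => // x xe; apply: bigmax_le => // y ye.
  by move: xe ye; rewrite !inE => /orP[]/eqP-> /orP[]/eqP->;
     rewrite ?((d0 _ _).2 erefl) // dC.
have ue : u \in [set u; v] by rewrite set21.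
have ve : v \in [set u; v] by rewrite set22.
by apply: le_trans (le_bigmax_cond _ _ ue); apply: le_bigmax_cond.
Qed.

End Graph.

Section Offline.
Variables (R : realType) (V : finType) (M : R) (d : V -> V -> R).
Variable r : seq (V * V).

Definition terminals : {set V} :=
  [set x in [seq p.1 | p <- r] ++ [seq p.2 | p <- r]].

(* The bought edges H, and for every request i the rented edges Q_i. *)
Definition solution : finType :=
  ({set {set V}} * {ffun 'I_(size r) -> {set {set V}}})%type.

Definition feasible (S : solution) : bool :=
  [&& S.1 \subset complete_edges V,
      [forall i, S.2 i \subset complete_edges V]
    & [forall i, connects (S.1 :|: S.2 i) (tnth (in_tuple r) i).1
                                          (tnth (in_tuple r) i).2]].

Definition cost (S : solution) : R :=
  M * total_length d S.1 + \sum_i total_length d (S.2 i).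

(* Buying the whole graph is feasible, so it serves as the default of the
   minimisation; see [OPT_attained] and [OPT_le]. *)
Definition buy_all : solution := (complete_edges V, [ffun=> set0]).

Definition OPT : R := cost [arg min_(S < buy_all | feasible S) cost S]%O.

Lemma feasible_buy_all : feasible buy_all.
Proof.
rewrite /feasible /= subxx /=; apply/andP; split; apply/forallP => i;
  rewrite ffunE ?sub0set // setU0.
case: (tnth _ i) => u v /=; have [->|uv] := eqVneq u v; first exact: connect0.
by apply: connect1; rewrite /= inE cards2 uv.
Qed.

Lemma OPT_attained : exists2 S, feasible S & OPT = cost S.
Proof.
rewrite /OPT; case: arg_minP => [|S fS _]; first exact: feasible_buy_all.
by exists S.
Qed.

Lemma OPT_le S : feasible S -> OPT <= cost S.
Proof.
move=> fS; rewrite /OPT; case: arg_minP => [|S' _]; last exact.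
exact: feasible_buy_all.
Qed.

End Offline.

(* [(j, false)] stands for s_j and [(j, true)] for t_j. *)
Definition position (n : nat) : finType := ('I_n * bool)%type.

(* A deterministic online algorithm is given the parameter M and, right after
   the n-th request, only the distances between the endpoints of the first n
   requests. It answers with the edges it buys and the edges it rents at that
   step, given by positions; two positions are the same vertex exactly when
   their distance is 0. Its earlier decisions are determined by the same data,
   so they need not be passed as arguments. *)
Definition online_algorithm (R : realType) : Type :=
  R -> forall n : nat, {ffun position n * position n -> R} ->
    {set position n * position n} * {set position n * position n}.

Section Online.
Variables (R : realType) (A : online_algorithm R).
Variables (V : finType) (M : R) (d : V -> V -> R).

Definition endpoint (s : seq (V * V)) (p : position (size s)) : V :=
  let q := tnth (in_tuple s) p.1 in if p.2 then q.2 else q.1.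

Definition submetric (s : seq (V * V)) :
    {ffun position (size s) * position (size s) -> R} :=
  [ffun p => d (endpoint p.1) (endpoint p.2)].

(* Pairs of positions of the same vertex are not edges and are dropped. *)
Definition edges_at (s : seq (V * V))
    (B : {set position (size s) * position (size s)}) : {set {set V}} :=
  [set [set endpoint p.1; endpoint p.2] | p in B
     & endpoint p.1 != endpoint p.2].

(* Below, [s] is the sequence of requests up to and including the current one. *)
Definition buys (s : seq (V * V)) : {set {set V}} :=
  edges_at (A M (submetric s)).1.

Definition rents (s : seq (V * V)) : {set {set V}} :=
  edges_at (A M (submetric s)).2.

Definition bought (s : seq (V * V)) : {set {set V}} :=
  \bigcup_(i < size s) buys (take i.+1 s).

Definition serves_online (r : seq (V * V)) : Prop :=
  forall i : 'I_(size r),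
    connects (bought (take i.+1 r) :|: rents (take i.+1 r))
      (tnth (in_tuple r) i).1 (tnth (in_tuple r) i).2.

Definition online_solution (r : seq (V * V)) : solution r :=
  (bought r, [ffun i : 'I_(size r) => rents (take i.+1 r)]).

Definition online_cost (r : seq (V * V)) : R := cost M d (online_solution r).

End Online.

Definition rent_or_buy_algorithm (R : realType) (A : online_algorithm R) : Prop :=
  forall (V : finType) (d : V -> V -> R) (M : R) (r : seq (V * V)),
    is_metric d -> min_edge_length_1 d -> 0 <= M -> serves_online A M d r.

Definition O_log_competitive (R : realType) (A : online_algorithm R) : Prop :=
  exists c : R,
  forall (V : finType) (d : V -> V -> R) (M : R) (r : seq (V * V)),
    is_metric d -> min_edge_length_1 d -> 0 <= M ->
    (2 <= #|terminals r|)%N ->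
    online_cost A M d r <= c * ln (#|terminals r|%:R) * OPT M d r.

(* Main.v *)
Require Import Defs.
From mathcomp Require Import all_boot all_order all_fingroup all_algebra.
From mathcomp Require Import reals exp ring lra.

(** The algorithm rents until it has seen enough rent paid locally, then buys. A request at
    distance about [2^a] is served either directly or through two hubs that have been bought
    into the same component. When it pays rent about [2^h] it is charged, at one endpoint,
    to scale [h]; this happens only if no hub of class at least [h] lies within [2^h] of that
    endpoint. Once [max 1 M] charges of scale [h] lie within [2^h / 2] of the current endpoint,
    the endpoint becomes a hub of class [h] and is joined to every hub at distance less than
    [3 * 2^(smaller class)]. Two hubs of class [h] cannot share a witness, so the purchases
    are paid by the charges, and a set of diameter less than [2^h / 2] carries at most
    [max 1 M + 1] charges of scale [h].

    For the lower bound, fix a radius [r] in [(2^h / 8, 2^h / 4]] and a permutation of the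
    vertices, and send every vertex to the first terminal within distance [r]. Every cluster
    with charges of scale [h] separates the charged pairs, so the optimum either buys an edge
    leaving it or rents one for each of these pairs. As in the Calinescu-Karloff-Rabani and
    Fakcharoenphol-Rao-Talwar decompositions, averaging over the permutation and integrating
    over [r] makes an edge of length [l] contribute at most [l] times the harmonic number of
    the number of terminals. No laminarity between scales is needed. *)

Set Implicit Arguments.
Unset Strict Implicit.
Unset Printing Implicit Defensive.
Import Order.TTheory GRing.Theory Num.Theory.
Local Open Scope ring_scope.

(** * The algorithm and its invariant *)

Section Connects.
Variable V : finType.
Implicit Types (F : {set {set V}}) (u v w : V).

Lemma connects_sym F u v : connects F u v = connects F v u.
Proof.
by apply: sym_connect_sym => x y /=; rewrite setUC.
Qed.

Lemma connects_sub F1 F2 u v : F1 \subset F2 -> connects F1 u v -> connects F2 u v.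
Proof.
move=> /subsetP sF; apply: connect_sub => x y /= xy; apply: connect1; exact: sF.
Qed.

Lemma connects_trans F v u w : connects F u v -> connects F v w -> connects F u w.
Proof. exact: connect_trans. Qed.

Lemma connects_cut F (C : pred V) u v : connects F u v -> C u -> ~~ C v ->
  exists x y, [/\ [set x; y] \in F, C x & ~~ C y].
Proof.
case/connectP=> p; elim: p u => [|x p IHp] u /=; first by move=> _ -> Cu; rewrite Cu.
case/andP=> ux xp vE Cu Cv; have [Cx|nCx] := boolP (C x); first exact: (IHp x).
by exists u, x.
Qed.

End Connects.

Notation reqpos := (nat * bool)%type.

Section EdgeSet.
Variables (R : realType) (V : finType) (d : V -> V -> R) (pt : reqpos -> V).
Hypothesis d_metric : is_metric d.

(** Different request endpoints may be the same vertex, so a pair in [F] may collapse to a point,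
    and several pairs may give one edge. [seq_length] counts such pairs separately, hence only
    bounds the true length from above. *)
Definition edge_set (F : seq (reqpos * reqpos)) : {set {set V}} :=
  [set e in [seq [set pt p.1; pt p.2] | p <- F & pt p.1 != pt p.2]].

Definition seq_length (F : seq (reqpos * reqpos)) : R :=
  \sum_(p <- F) d (pt p.1) (pt p.2).

Lemma edge_length_ge0 (e : {set V}) : 0 <= edge_length d e.
Proof. exact: bigmax_ge_id. Qed.

Lemma total_length_ge0 F : 0 <= total_length d F.
Proof. by apply: sumr_ge0 => e _; apply: edge_length_ge0. Qed.

Lemma total_length_edge_set F : total_length d (edge_set F) <= seq_length F.
Proof.
rewrite /total_length /seq_length.
under eq_bigl do rewrite inE.
elim: F => [|p F IHF] /=; first by rewrite big_nil big_pred0.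
rewrite big_cons; have d0 := metric_ge0 d_metric.
case: ifP => [pn|_]; last by rewrite -[leLHS]add0r lerD.
rewrite /= -(edge_lengthE _ _ d_metric).
apply: le_trans (lerD (lexx _) IHF); set e := [set _; _]; set s := map _ _.
case: (boolP (e \in s)) => es.
  rewrite -[leLHS]add0r lerD ?edge_length_ge0 //.
  rewrite le_eqVlt; apply/orP; left; apply/eqP; apply: eq_bigl => x.
  by rewrite inE; case: eqP => // ->.
rewrite (bigD1 e) ?mem_head //= lerD2l.
rewrite le_eqVlt; apply/orP; left; apply/eqP; apply: eq_bigl => x.
by rewrite inE; case: eqP => //= [->|_]; rewrite ?andbT // (negPf es).
Qed.

Lemma edge_set_sub F1 F2 : {subset F1 <= F2} -> edge_set F1 \subset edge_set F2.
Proof.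
move=> sF; apply/subsetP=> e; rewrite !inE => /mapP[p].
rewrite mem_filter => /andP[pn pF] ->; apply/mapP; exists p => //.
by rewrite mem_filter pn sF.
Qed.

Lemma connects_edge_set F (p : reqpos * reqpos) :
  p \in F -> connects (edge_set F) (pt p.1) (pt p.2).
Proof.
move=> pF; have [->|pn] := eqVneq (pt p.1) (pt p.2); first exact: connect0.
apply: connect1; rewrite /= inE; apply/mapP; exists p => //.
by rewrite mem_filter pn.
Qed.

End EdgeSet.

(* [level S i] is the scale charged by request [i], if any, [site S i] the endpoint charged,
   and [lab S i] the index of a hub of largest class in the component of the hub [i]. *)
Record state := State {
  level : nat -> option nat;
  side : nat -> bool;
  hub : nat -> bool;
  lab : nat -> nat;
  tree : seq (reqpos * reqpos);
  rented : seq (reqpos * reqpos) }.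

Definition site S i : reqpos := (i, side S i).
Definition cls S i : nat := odflt 0%N (level S i).

Definition init := State (fun _ => None) (fun _ => false) (fun _ => false) id [::] [::].

Definition attach n S u :=
  if lab S u == lab S n then S else
  let: (x, y) := if (cls S (lab S u) <= cls S (lab S n))%N
                 then (lab S u, lab S n) else (lab S n, lab S u) in
  State (level S) (side S) (hub S) (fun w => if lab S w == x then y else lab S w)
        ((site S u, site S n) :: tree S) (rented S).

Section Algorithm.
Variables (R : realType) (theta : R) (D : reqpos -> reqpos -> R).

Definition pair_class n : nat :=
  (trunc_log 2 (Num.truncn (D (n, false) (n, true)))).+1.

(** The last condition ties [u] to a hub whose class is at least that of the pair. Such hubs near
    the two endpoints are always joined to each other, so anchors of both endpoints lie in one
    bought component. *)
Definition anchors S n (p : reqpos) h u : bool :=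
  [&& hub S u, (h <= cls S u)%N, D p (site S u) < 2 ^+ h
    & has (fun w => [&& hub S w, (pair_class n <= cls S w)%N,
                      D p (site S w) < 2 ^+ pair_class n & lab S u == lab S w])
          (iota 0 n)].

(* [pair_class n + 1] when no scale is suitable. *)
Definition reach S n p : nat :=
  find (fun h => has (anchors S n p h) (iota 0 n)) (iota 0 (pair_class n).+1).

Definition anchor S n p : reqpos :=
  site S (nth 0%N (iota 0 n) (find (anchors S n p (reach S n p)) (iota 0 n))).

Definition near S n u : bool :=
  hub S u && (D (site S u) (site S n) < 3 * 2 ^+ minn (cls S u) (cls S n)).

(** The range ends at [n] included: a charged request is one of its own witnesses. *)
Definition witnesses S n : nat :=
  count (fun i => (level S i == level S n) &&
                  (D (site S i) (site S n) < 2 ^+ cls S n / 2)) (iota 0 n.+1).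

(** The level lies one below the larger reach [g], so it is the last scale at which that endpoint
    has no anchor; [side] selects this endpoint. If [g = 0], both endpoints coincide with their
    anchors and nothing is charged. *)
Definition charge n S : state :=
  let s := (n, false) in let t := (n, true) in
  let gs := reach S n s in let gt := reach S n t in
  let g := if D s t == 0 then 0%N else maxn gs gt in
  State [eta level S with n |-> if g is h.+1 then Some h else None]
        [eta side S with n |-> (gs < gt)%N] (hub S) (lab S) (tree S)
        (if D s t == 0 then [::] else
         if g == (pair_class n).+1 then [:: (s, t)]
         else [:: (s, anchor S n s); (t, anchor S n t)]).

Definition open_hub n S : state :=
  if level S n && (theta <= (witnesses S n)%:R) then
    let S' := State (level S) (side S) [eta hub S with n |-> true]
                    (lab S) (tree S) (rented S) in
    foldl (attach n) S' [seq u <- iota 0 n | near S' n u]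
  else S.

Definition step n S := open_hub n (charge n S).

Fixpoint run n : state := if n is m.+1 then step m (run m) else init.

End Algorithm.

Arguments pair_class : simpl never.
Arguments step : simpl never.
Arguments charge : simpl never.
Arguments open_hub : simpl never.
Arguments attach : simpl never.

(** * Dependence of a run on the distances seen so far *)

Section Locality.
Variables (R : realType) (theta : R) (D D' : reqpos -> reqpos -> R).

Lemma eq_step n S :
  (forall p q, (p.1 <= n)%N -> (q.1 <= n)%N -> D p q = D' p q) ->
  step theta D n S = step theta D' n S.
Proof.
move=> DD'.
have pcE : pair_class D n = pair_class D' n by rewrite /pair_class DD'.
have anE p h u : (p.1 <= n)%N -> (u < n)%N -> anchors D S n p h u = anchors D' S n p h u.
  move=> pn un; rewrite /anchors pcE DD' ?(ltnW un) //=; congr [&& _, _, _ & _].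
  apply: eq_in_has => w; rewrite mem_iota => /andP[_ wn].
  by rewrite DD' // ltnW.
have reE p : (p.1 <= n)%N -> reach D S n p = reach D' S n p.
  move=> pn; rewrite /reach pcE; apply: eq_find => h.
  by apply: eq_in_has => u; rewrite mem_iota => /andP[_ un]; apply: anE.
have acE p : (p.1 <= n)%N -> anchor D S n p = anchor D' S n p.
  move=> pn; rewrite /anchor (reE _ pn); congr (site _ (nth _ _ _)).
  by apply: eq_in_find => u; rewrite mem_iota => /andP[_ un]; apply: anE.
have chE : charge D n S = charge D' n S.
  have [ln ln'] : ((n, false).1 <= n)%N /\ ((n, true).1 <= n)%N by [].
  rewrite /charge (DD' _ _ ln ln') (reE _ ln) (reE _ ln') (acE _ ln) (acE _ ln') pcE.
  reflexivity.
rewrite /step chE /open_hub; move: (charge _ _ _) => S1.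
have -> : witnesses D S1 n = witnesses D' S1 n.
  rewrite /witnesses; apply: eq_in_count => i; rewrite mem_iota => /andP[_ ni].
  by rewrite DD'.
case: ifP => _; last reflexivity.
congr foldl; apply: eq_in_filter => u.
rewrite mem_iota /near => /andP[_ un].
by rewrite (DD' _ _ (ltnW un : (site _ u).1 <= n)%N (leqnn n : (site _ n).1 <= n)%N).
Qed.

Lemma eq_run n :
  (forall p q, (p.1 < n)%N -> (q.1 < n)%N -> D p q = D' p q) ->
  run theta D n = run theta D' n.
Proof.
elim: n => [|n IHn] DD'; first reflexivity.
rewrite /= (IHn _); last by move=> p q pn qn; apply: DD'; apply: ltnW.
exact: eq_step.
Qed.

End Locality.

(** * Invariants preserved by one request *)

Section Invariant.
Variables (R : realType) (V : finType) (d : V -> V -> R) (pt : reqpos -> V).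
Hypothesis d_metric : is_metric d.

Local Notation D := (fun p q => d (pt p) (pt q)).

Record forest n S : Prop := {
  hub_lt : forall i, hub S i -> (i < n)%N;
  hub_lab : forall i, hub S i -> hub S (lab S i);
  labK : forall i, lab S (lab S i) = lab S i;
  cls_lab : forall i, hub S i -> (cls S i <= cls S (lab S i))%N;
  lab_out : forall i, ~~ hub S i -> lab S i = i;
  lab_connects : forall i j, hub S i -> hub S j -> lab S i = lab S j ->
    connects (edge_set pt (tree S)) (pt (site S i)) (pt (site S j));
  tree_lt : forall e, e \in tree S -> (e.1.1 < n)%N && (e.2.1 < n)%N;
  (* Kruskal potential: merging two components erases the root of smaller class,
     whose term pays for the new edge. *)
  tree_cost : seq_length d pt (tree S)
      + 3 * \sum_(0 <= i < n | hub S i && (lab S i == i)) 2 ^+ cls S i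
    <= 3 * \sum_(0 <= i < n | hub S i) 2 ^+ cls S i }.

(** The nontrivial outcome of [attach], with the absorbed root [x], the surviving root [y] and the
    edge as parameters, so that one proof serves both directions of merging. *)
Definition link S x y e :=
  State (level S) (side S) (hub S) (fun w => if lab S w == x then y else lab S w)
        (e :: tree S) (rented S).

Lemma link_forest n S a b e :
  let x := lab S a in let y := lab S b in
  forest n S -> hub S a -> hub S b -> x != y -> (cls S x <= cls S y)%N ->
  d (pt e.1) (pt e.2) < 3 * 2 ^+ cls S x ->
  e = (site S a, site S b) \/ e = (site S b, site S a) ->
  forest n (link S x y e).
Proof.
move=> x y fS ha req_hub xy cxy de eE.
have hx : hub S x := hub_lab fS ha.
have hy : hub S y := hub_lab fS req_hub.
have lx : lab S x = x := labK fS a.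
have ly : lab S y = y := labK fS b.
have sub_tree : edge_set pt (tree S) \subset edge_set pt (tree (link S x y e)).
  by apply: edge_set_sub => f fT; rewrite inE fT orbT.
have oldc i j : hub S i -> hub S j -> lab S i = lab S j ->
    connects (edge_set pt (tree (link S x y e))) (pt (site S i)) (pt (site S j)).
  by move=> hi hj ij; apply: connects_sub sub_tree _; apply: lab_connects fS _ _ hi hj ij.
have ab : connects (edge_set pt (tree (link S x y e))) (pt (site S a)) (pt (site S b)).
  have /(connects_edge_set pt) : e \in tree (link S x y e) by rewrite mem_head.
  by case: eE => -> //; rewrite connects_sym.
have xyc i j : hub S i -> hub S j -> lab S i = x -> lab S j = y ->
    connects (edge_set pt (tree (link S x y e))) (pt (site S i)) (pt (site S j)).
  move=> hi hj ix jy; apply: connects_trans (oldc _ _ hi ha ix) _.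
  by apply: connects_trans ab (oldc _ _ req_hub hj _); rewrite jy.
split=> /=.
- exact: hub_lt fS.
- by move=> i hi; case: eqP => // _; apply: hub_lab fS _ hi.
- move=> i; case: (eqVneq (lab S i) x) => [_|ix]; first by rewrite ly; case: ifP.
  by rewrite (labK fS) (negPf ix).
- move=> i hi; case: eqP => [ix|_]; last exact: cls_lab fS _ hi.
  by apply: leq_trans cxy; rewrite -ix; apply: cls_lab fS _ hi.
- move=> i nhi; rewrite (lab_out fS nhi); case: eqP => // ix.
  by rewrite ix hx in nhi.
- move=> i j hi hj; case: eqP => [ix|_]; case: eqP => [jx|_] //.
  + by move=> _; apply: oldc; rewrite // ix jx.
  + by move=> jy; apply: xyc.
  + by move=> iy; rewrite connects_sym; apply: xyc.
  + exact: oldc.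
- move=> f; rewrite inE => /orP[/eqP->|]; last exact: tree_lt fS _.
  by case: eE => -> /=; rewrite !(hub_lt fS).
(* Merging removes exactly [x] from the roots; the released [3 * 2 ^+ cls S x] exceeds the length of
   the new edge. *)
- have roots : \sum_(0 <= i < n | hub S i && (lab S i == i)) 2 ^+ cls S i =
      2 ^+ cls S x + \sum_(0 <= i < n | hub S i && ((if lab S i == x then y else lab S i) == i))
        2 ^+ cls S i :> R.
    rewrite big_mkcond (bigD1_seq x) ?iota_uniq ?mem_index_iota ?(hub_lt fS) //=.
    rewrite hx lx eqxx /=; congr +%R; rewrite -big_mkcondr; apply: eq_bigl => i.
    rewrite andbC -andbA; congr andb; case: (eqVneq i x) => [->|ix].
      by rewrite lx eqxx andbF eq_sym (negPf xy).
    rewrite andbT; case: (eqVneq (lab S i) x) => [e1|//].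
    apply/eqP/eqP=> [li|yi]; first by rewrite -li e1 eqxx in ix.
    by rewrite -yi ly in e1; rewrite e1 eqxx in xy.
  have := tree_cost fS; rewrite roots /seq_length big_cons /cls /=.
  by move: de; rewrite /cls; lra.
Qed.

(** A root has at least the class of every hub in its component, so an edge shorter than
    [3 * 2 ^+ minn (cls S u) (cls S n)] can be paid by whichever root is absorbed. *)
Lemma attach_forest n S u : let S' := attach n S u in
  forest n.+1 S -> hub S n -> hub S u ->
  d (pt (site S u)) (pt (site S n)) < 3 * 2 ^+ minn (cls S u) (cls S n) ->
  [/\ forest n.+1 S', lab S' u = lab S' n
    & forall i j, lab S i = lab S j -> lab S' i = lab S' j].
Proof.
move=> S' fS hn hu dun; rewrite /S' /attach; have [e|un] := eqVneq (lab S u) (lab S n).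
  by split.
have [cu cn] : (cls S u <= cls S (lab S u))%N /\ (cls S n <= cls S (lab S n))%N.
  by split; apply: cls_lab fS _ _.
have le2 k l : (k <= l)%N -> (2 : R) ^+ k <= 2 ^+ l.
  by move=> kl; rewrite ler_eXn2l ?ltr1n.
case: leqP => c12; (split=> /=; [
  | by rewrite eqxx; case: eqP
  | by move=> i j ->]).
- apply: (link_forest fS hu hn) => //=; last by left.
  apply: lt_le_trans dun _; rewrite ler_pM2l // le2 //.
  by apply: leq_trans cu; apply: geq_minl.
- apply: (link_forest fS hn hu); rewrite 1?eq_sym 1?ltnW //=; last by right.
  apply: lt_le_trans dun _; rewrite ler_pM2l // le2 //.
  by apply: leq_trans cn; apply: geq_minr.
Qed.

Lemma attach_fields n S u : let S' := attach n S u in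
  [/\ level S' = level S, side S' = side S, hub S' = hub S, rented S' = rented S
    & {subset tree S <= tree S'}].
Proof.
rewrite /attach; case: ifP => _; first by split.
by case: leqP => _; split=> // e eT; rewrite inE eT orbT.
Qed.

Lemma foldl_attach n S L : let S' := foldl (attach n) S L in
  forest n.+1 S -> hub S n ->
  (forall u, u \in L -> hub S u /\
    d (pt (site S u)) (pt (site S n)) < 3 * 2 ^+ minn (cls S u) (cls S n)) ->
  [/\ forest n.+1 S', forall u, u \in L -> lab S' u = lab S' n
    & forall i j, lab S i = lab S j -> lab S' i = lab S' j].
Proof.
elim: L S => [|u L IHL] S /= fS hn hL; first by split.
have [hu du] := hL u (mem_head _ _).
have [f1 l1 k1] := attach_forest fS hn hu du.
have [eL eS eH _ _] := attach_fields n S u.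
have [||f2 l2 k2] := IHL (attach n S u) f1; first by rewrite eH.
  by move=> v vL; rewrite eH /site /cls eL eS; apply: hL; rewrite inE vL orbT.
split=> // [v|i j ij]; last by apply: k2; apply: k1.
by rewrite inE => /orP[/eqP->|]; [apply: k2 | apply: l2].
Qed.

Lemma foldl_attach_fields n S L : let S' := foldl (attach n) S L in
  [/\ level S' = level S, side S' = side S, hub S' = hub S, rented S' = rented S
    & {subset tree S <= tree S'}].
Proof.
elim: L S => [|u L IHL] S /=; first by split.
have [eL eS eH eR eT] := attach_fields n S u.
have [-> -> -> -> sT] := IHL (attach n S u).
by split=> // e /eT /sT.
Qed.

Definition near_joined S : Prop := forall i j, hub S i -> hub S j ->
  d (pt (site S i)) (pt (site S j)) < 3 * 2 ^+ minn (cls S i) (cls S j) ->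
  lab S i = lab S j.

Hypothesis d_ge1 : forall u v, u != v -> 1 <= d u v.

Let Dsym p q : d (pt p) (pt q) = d (pt q) (pt p).
Proof. by case: d_metric. Qed.

Let Dtri p q r : d (pt p) (pt r) <= d (pt p) (pt q) + d (pt q) (pt r).
Proof. by case: d_metric. Qed.

Let Dxx p : d (pt p) (pt p) = 0.
Proof. by case: d_metric => d0 _ _; apply/d0. Qed.

Let Dlt1 p q : d (pt p) (pt q) < 1 -> pt p = pt q.
Proof. by move=> lt1; apply: contraTeq lt1 => /d_ge1; rewrite leNgt. Qed.

Let le2 k l : (k <= l)%N -> (2 : R) ^+ k <= 2 ^+ l.
Proof. by move=> kl; rewrite ler_eXn2l ?ltr1n. Qed.

Lemma pair_class_gt n : D (n, false) (n, true) < 2 ^+ pair_class D n.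
Proof.
have := metric_ge0 d_metric (pt (n, false)) (pt (n, true)) => /Num.Theory.truncn_itv /andP[_].
move/lt_le_trans; apply; rewrite -natrX ler_nat /pair_class.
exact: trunc_log_ltn.
Qed.

Lemma pair_class_le n :
  pt (n, false) <> pt (n, true) -> 2 ^+ pair_class D n / 2 <= D (n, false) (n, true).
Proof.
move=> /eqP /d_ge1 d1; have := metric_ge0 d_metric (pt (n, false)) (pt (n, true)).
move=> /Num.Theory.truncn_itv /andP[le_d _]; apply: le_trans le_d.
rewrite /pair_class exprS mulrC mulKf ?pnatr_eq0 // -natrX ler_nat.
by apply: trunc_logP => //; rewrite Num.Theory.truncn_gt0.
Qed.

Lemma reach_le S n p : (reach D S n p <= (pair_class D n).+1)%N.
Proof. by rewrite (leq_trans (find_size _ _)) // size_iota. Qed.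

Lemma anchor_spec S n p : (reach D S n p <= pair_class D n)%N ->
  exists2 u, anchors D S n p (reach D S n p) u & anchor D S n p = site S u.
Proof.
rewrite -ltnS => lt_re; have h0 := lt_re.
rewrite -[X in (_ < X)%N](size_iota 0) -has_find in lt_re.
have := nth_find 0%N lt_re; rewrite -/(reach D S n p) nth_iota // add0n => hu.
exists (nth 0%N (iota 0 n) (find (anchors D S n p (reach D S n p)) (iota 0 n))) => //.
exact: nth_find.
Qed.

Lemma before_reach S n p h u :
  (h < reach D S n p)%N -> (u < n)%N -> ~~ anchors D S n p h u.
Proof.
move=> hr un; have := before_find 0%N hr; rewrite nth_iota ?add0n; last first.
  by apply: leq_trans hr _; apply: reach_le.
by move/hasPn; apply; rewrite mem_iota.
Qed.

(** Minimality of [reach] only excludes anchors of scale [h]; this upgrades it to all hubs of class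
    at least [h]. At the top scale a close hub would be its own anchor. Below it, a close hub would
    be joined to the anchor found at scale [h.+1] and would inherit the large hub of that anchor. *)
Lemma far_hub n S p h i : forest n S -> near_joined S ->
  reach D S n p = h.+1 -> hub S i -> (h <= cls S i)%N ->
  2 ^+ h <= d (pt p) (pt (site S i)).
Proof.
move=> fS sS re hi hc; rewrite leNgt; apply/negP => lt_d.
have i_n := hub_lt fS hi.
have := reach_le S n p; rewrite re ltnS => ha.
have : ~~ anchors D S n p h i by apply: before_reach => //; rewrite re.
rewrite /anchors hi hc lt_d /= => /hasPn no_w.
have [eq_ha|lt_ha] := eqVneq h (pair_class D n).
  have := no_w i; rewrite mem_iota /= => /(_ i_n).
  by rewrite hi eqxx -eq_ha hc lt_d.
have /anchor_spec[u] : (reach D S n p <= pair_class D n)%N by rewrite re ltn_neqAle lt_ha.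
rewrite re /anchors => /and4P[hu cu du /hasP[w wn /and4P[hw cw dw /eqP uw]]] _.
(* The distance is below [2 ^+ h + 2 ^+ h.+1 = 3 * 2 ^+ h], which is where the factor 3 in [near]
   comes from. *)
have lab_iu : lab S i = lab S u.
  apply: sS => //; apply: (@lt_le_trans _ _ (3 * 2 ^+ h)); last first.
    by rewrite ler_pM2l // le2 // leq_min hc ltnW.
  have := Dtri (site S i) p (site S u); rewrite (Dsym (site S i) p).
  by move: lt_d du; rewrite exprS /=; lra.
by have := no_w w wn; rewrite hw cw dw lab_iu uw eqxx.
Qed.

Lemma charge_level n S : forest n S -> near_joined S -> let S' := charge D n S in
  match level S' n with
  | None => seq_length d pt (rented S') = 0
  | Some h => [/\ seq_length d pt (rented S') <= 4 * 2 ^+ h,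
      2 ^+ h / 2 <= D (n, false) (n, true)
    & forall i, hub S i -> (h <= cls S i)%N -> 2 ^+ h <= D (site S' n) (site S i)]
  end.
Proof.
move=> fS sS /=; rewrite /site /= eqxx.
set a := pair_class D n; set gs := reach D S n _; set gt := reach D S n _.
case: eqP => [_|dn0]; first by rewrite /seq_length big_nil.
have nst : pt (n, false) <> pt (n, true) by move=> e; apply: dn0; rewrite e Dxx.
have lt_da := pair_class_gt n; have le_da := pair_class_le nst.
have := reach_le S n (n, false); have := reach_le S n (n, true).
rewrite -/gs -/gt -/a => gta gsa.
have anch p : (reach D S n p <= a)%N -> D p (anchor D S n p) < 2 ^+ reach D S n p.
  by move=> /anchor_spec[u] /and4P[_ _ du _] ->.
case: (posnP (maxn gs gt)) => [g0|]; last first.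
  case g: (maxn gs gt) => [//|h] _.
  have ha : (h <= a)%N by rewrite -ltnS -g geq_max gsa.
  split.
  - case: eqP => [[hE]|/eqP]; rewrite /seq_length ?big_cons big_nil /= addr0.
      (* Direct service: here [h] is the class of the pair, whose distance is below [2 ^+ h].
         Otherwise the two rented edges are each shorter than [2 ^+ h.+1], which gives the factor
         4. *)
      by move: lt_da; rewrite -/a -hE; have := @exprn_ge0 R h 2 (ler0n _ _); lra.
    rewrite eqSS => hna; have {hna} : (maxn gs gt <= a)%N by rewrite g ltn_neqAle hna.
    rewrite geq_max => /andP[/anch + /anch]; rewrite -/gs -/gt => ds dt.
    have [gsh gth] : (gs <= h.+1)%N /\ (gt <= h.+1)%N by rewrite -g leq_maxl leq_maxr.
    by have := le2 gsh; have := le2 gth; move: ds dt; rewrite exprS /=; lra.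
  - by apply: le_trans le_da; rewrite ler_pM2r ?invr_gt0 // le2.
  - move=> i hi hc; apply: (far_hub fS sS) => //; rewrite -g.
    by rewrite /maxn; case: ltnP.
have [gs0 gt0] : gs = 0%N /\ gt = 0%N.
  by split; apply/eqP; rewrite -leqn0 -g0 ?leq_maxl ?leq_maxr.
(* An anchor of scale 0 is at distance less than 1, the minimum edge length, hence at distance 0. *)
have zero p : reach D S n p = 0%N -> D p (anchor D S n p) = 0.
  by move=> re; have := anch p; rewrite re expr0 => /(_ isT) /Dlt1 <-; rewrite Dxx.
by rewrite g0 /= /seq_length !big_cons big_nil /= !zero // !addr0.
Qed.

Lemma charge_connects n S : forest n S -> near_joined S -> let S' := charge D n S in
  connects (edge_set pt (tree S) :|: edge_set pt (rented S')) (pt (n, false)) (pt (n, true)).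
Proof.
move=> fS sS; rewrite /charge /=.
set a := pair_class D n; set gs := reach D S n _; set gt := reach D S n _.
case: eqP => [/eqP|dn0].
  by case: d_metric => d0 _ _ /eqP /d0 ->; apply: connect0.
case: eqP => [_|/eqP hna].
  apply: (connects_sub (subsetUr _ _)).
  by apply: (@connects_edge_set _ _ _ ((n, false), (n, true))); rewrite mem_head.
have := reach_le S n (n, false); have := reach_le S n (n, true).
rewrite -/gs -/gt -/a => gta gsa.
have : (maxn gs gt <= a)%N by rewrite -ltnS ltn_neqAle hna geq_max gsa.
rewrite geq_max => /andP[/anchor_spec[u hu ->] /anchor_spec[v hv ->]].
have lt_da := pair_class_gt n.
move: hu hv => /and4P[hu _ _ /hasP[x xn /and4P[hx cx dx /eqP ux]]].
move=> /and4P[hv _ _ /hasP[y yn /and4P[hy cy dy /eqP vy]]].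
(* From [x] to one endpoint, across the pair and on to [y] are three steps, each shorter than
   [2 ^+ a], and both hubs have class at least [a]. *)
have xy : lab S x = lab S y.
  apply: sS => //; apply: (@lt_le_trans _ _ (3 * 2 ^+ a)); last first.
    by rewrite ler_pM2l // le2 // leq_min cx.
  have := Dtri (site S x) (n, false) (site S y); have := Dtri (n, false) (n, true) (site S y).
  by rewrite (Dsym (site S x) (n, false)); move: dx dy lt_da; rewrite -/a; lra.
have uv : connects (edge_set pt (tree S)) (pt (site S u)) (pt (site S v)).
  by apply: (lab_connects fS) => //; rewrite ux xy -vy.
set Q := [:: _; _].
apply: (@connects_trans _ _ (pt (site S u))).
  apply: (connects_sub (subsetUr _ _)).
  by apply: (@connects_edge_set _ _ _ ((n, false), site S u)); rewrite mem_head.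
apply: connects_trans (connects_sub (subsetUl _ _) uv) _.
rewrite connects_sym; apply: (connects_sub (subsetUr _ _)).
by apply: (@connects_edge_set _ _ _ ((n, true), site S v)); rewrite !inE eqxx orbT.
Qed.

Lemma charge_rented_lt n S e : forest n S -> e \in rented (charge D n S) ->
  (e.1.1 < n.+1)%N && (e.2.1 < n.+1)%N.
Proof.
move=> fS; rewrite /charge /=; case: eqP => // _.
case: eqP => [_|/eqP hna]; first by rewrite inE => /eqP-> /=; rewrite ltnSn.
have : (maxn (reach D S n (n, false)) (reach D S n (n, true)) <= pair_class D n)%N.
  by rewrite -ltnS ltn_neqAle hna geq_max !reach_le.
rewrite geq_max => /andP[/anchor_spec[u /and4P[/(hub_lt fS) hu _ _ _] ->]].
move=> /anchor_spec[v /and4P[/(hub_lt fS) hv _ _ _] ->].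
by rewrite !inE => /orP[] /eqP-> /=; rewrite ltnSn ltnW.
Qed.

(** Request [n] enters as an isolated node. If it is a hub, it is its own root, so both sides of the
    potential inequality gain the same term. *)
Lemma extend_forest n S S' b : forest n S ->
    (forall i, i != n -> level S' i = level S i) ->
    (forall i, i != n -> side S' i = side S i) ->
    (forall i, hub S' i = if i == n then b else hub S i) ->
    lab S' = lab S -> tree S' = tree S ->
  forest n.+1 S'.
Proof.
move=> fS eL eS eH eLab eT.
have hub_n : hub S n = false by apply/negP => /(hub_lt fS); rewrite ltnn.
have hubn i : hub S i -> i != n by apply: contraTneq => ->; rewrite hub_n.
have lab_n : lab S n = n by apply: lab_out fS _ _; rewrite hub_n.
have clsE i : i != n -> cls S' i = cls S i by move=> ni; rewrite /cls eL.
have siteE i : i != n -> site S' i = site S i by move=> ni; rewrite /site eS.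
have lab_hub i : hub S i -> lab S i != n by move=> /(hub_lab fS) /hubn.
have sumE (P : pred nat) : \sum_(0 <= i < n.+1 | hub S' i && P i) 2 ^+ cls S' i =
    \sum_(0 <= i < n | hub S i && P i) 2 ^+ cls S i + (if b && P n then 2 ^+ cls S' n else 0) :> R.
  rewrite big_mkcond big_nat_recr //= eH eqxx; congr +%R.
  rewrite [RHS]big_mkcond; apply: eq_big_nat => i /andP[_ ni].
  by rewrite eH ltn_eqF // clsE // ltn_eqF.
split.
- by move=> i; rewrite eH; case: eqP => [->//|_ /(hub_lt fS)]; apply: leqW.
- move=> i; rewrite !eH eLab; case: eqP => [-> bT|_ hi].
    by rewrite lab_n eqxx.
  by rewrite (negPf (lab_hub _ hi)); apply: hub_lab fS _ hi.
- by move=> i; rewrite eLab (labK fS).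
- move=> i; rewrite eH eLab; case: eqP => [->|_ hi]; first by rewrite lab_n.
  by rewrite (clsE _ (hubn _ hi)) (clsE _ (lab_hub _ hi)) (cls_lab fS hi).
- move=> i; rewrite eH eLab; case: eqP => [->|_]; [by [] | exact: lab_out fS _].
- move=> i j; rewrite !eH eLab eT; case: eqP => [->|_] hi; case: eqP => [->|_] hj.
  + by move=> _; apply: connect0.
  + by rewrite lab_n => e; have := lab_hub _ hj; rewrite -e eqxx.
  + by rewrite lab_n => e; have := lab_hub _ hi; rewrite e eqxx.
  + by rewrite !siteE ?hubn //; apply: lab_connects fS _ _ hi hj.
- by move=> e; rewrite eT => /(tree_lt fS) /andP[e1 e2]; rewrite (leqW e1) (leqW e2).
- rewrite eT sumE; have := tree_cost fS; have := sumE predT.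
  under eq_bigl do rewrite andbT; under [in RHS]eq_bigl do rewrite andbT.
  by move=> ->; rewrite eLab lab_n eqxx /=; case: b {eH sumE} => /=; lra.
Qed.

Lemma step_fields theta n S : let C := charge D n S in let S' := step theta D n S in
  hub S n = false ->
  [/\ level S' = level C, side S' = side C, rented S' = rented C, {subset tree S <= tree S'}
    & forall i, hub S' i = if i == n then level C n && (theta <= (witnesses D C n)%:R)
                           else hub S i].
Proof.
move=> C S' hn; rewrite /S' /step /open_hub -/C.
case: ifP => cond; last first.
  by split=> // i; rewrite [LHS]/(hub S i); case: eqP => // ->.
set S1 := State _ _ _ _ _ _; set L := [seq _ <- _ | _].
by have [-> -> -> -> sT] := foldl_attach_fields n S1 L; split.
Qed.

(** A new hub is attached to every older hub near it, and attaching never separates hubs already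
    sharing a label; this restores [near_joined]. *)
Lemma step_inv theta n S : forest n S -> near_joined S ->
  forest n.+1 (step theta D n S) /\ near_joined (step theta D n S).
Proof.
move=> fS sS; set C := charge D n S.
have CL i : i != n -> level C i = level S i by move=> /negPf; rewrite /C /charge /= => ->.
have CS i : i != n -> side C i = side S i by move=> /negPf; rewrite /C /charge /= => ->.
have hub_n : hub S n = false by apply/negP => /(hub_lt fS); rewrite ltnn.
have hubn i : hub S i -> i != n by apply: contraTneq => ->; rewrite hub_n.
have sC i j : hub S i -> hub S j ->
    d (pt (site C i)) (pt (site C j)) < 3 * 2 ^+ minn (cls C i) (cls C j) ->
    lab S i = lab S j.
  move=> hi hj; rewrite /site /cls !CS ?CL ?hubn //; exact: sS.
rewrite /step -/C /open_hub; case: ifP => cond; last first.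
  split; last by move=> i j; apply: sC.
  by apply: (@extend_forest _ S _ false) => // i; case: eqP => // ->.
set S1 := State _ _ _ _ _ _; set L := [seq _ <- _ | _].
have fS1 : forest n.+1 S1 by apply: (@extend_forest _ S _ true).
have hn : hub S1 n by rewrite /= eqxx.
have LP u : u \in L -> hub S1 u /\
    d (pt (site S1 u)) (pt (site S1 n)) < 3 * 2 ^+ minn (cls S1 u) (cls S1 n).
  by rewrite mem_filter => /andP[/andP[]].
have [f2 l2 k2] := foldl_attach fS1 hn LP.
have [eL eS eH _ _] := foldl_attach_fields n S1 L; split=> // i j.
have inL u : hub S u -> d (pt (site S1 u)) (pt (site S1 n)) < 3 * 2 ^+ minn (cls S1 u) (cls S1 n) ->
    u \in L.
  move=> hu du; rewrite mem_filter mem_iota /= (hub_lt fS hu) andbT /near du andbT.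
  by rewrite /= hu; case: ifP.
rewrite eH /site /cls eL eS; rewrite [hub S1 i]/= [hub S1 j]/=.
case: (eqVneq i n) => [->|_] hi; case: (eqVneq j n) => [->|_] hj //.
- move=> dij; symmetry; apply: l2; apply: inL => //.
  by rewrite (Dsym (site S1 j)) minnC.
- by move=> dij; apply: l2; apply: inL.
- by move=> dij; apply: k2; apply: sC.
Qed.

End Invariant.

(** * Cost of the whole run and density of charges *)

Section Run.
Variables (R : realType) (V : finType) (d : V -> V -> R) (pt : reqpos -> V) (theta : R).
Hypothesis d_metric : is_metric d.
Hypothesis d_ge1 : forall u v, u != v -> 1 <= d u v.
Hypothesis theta_ge1 : 1 <= theta.

Local Notation D := (fun p q => d (pt p) (pt q)).
Local Notation st n := (run theta D n).

Definition req_level i := level (st i.+1) i.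
Definition req_class i := odflt 0%N (req_level i).
Definition req_hub i := hub (st i.+1) i.
Definition req_point i := pt (site (st i.+1) i).

Lemma run_inv n : forest d pt n (st n) /\ near_joined d pt (st n).
Proof.
elim: n => [|n [fS sS]]; last exact: step_inv.
split; last by [].
split=> //; by rewrite /seq_length !big_nil mulr0 addr0.
Qed.

Lemma run_step n : let C := charge D n (st n) in
  [/\ level (st n.+1) = level C, side (st n.+1) = side C, rented (st n.+1) = rented C,
      {subset tree (st n) <= tree (st n.+1)}
    & forall i, hub (st n.+1) i =
        if i == n then level C n && (theta <= (witnesses D C n)%:R) else hub (st n) i].
Proof.
have [fS _] := run_inv n.
by apply: step_fields; apply/negP => /(hub_lt fS); rewrite ltnn.
Qed.

(** Later requests never revise the level, site or hub status of [i], so these data can be read off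
    right after step [i]. *)
Lemma run_stable n i : (i < n)%N ->
  [/\ level (st n) i = req_level i, site (st n) i = site (st i.+1) i & hub (st n) i = req_hub i].
Proof.
elim: n => // n IHn; rewrite ltnS leq_eqVlt => /orP[/eqP->|i_n] //.
have [<- <- <-] := IHn i_n; have [eL eS _ _ eH] := run_step n.
by rewrite /site eL eS eH /= ltn_eqF.
Qed.

Lemma run_tree_sub m n : (m <= n)%N -> {subset tree (st m) <= tree (st n)}.
Proof.
elim: n => [|n IHn]; first by rewrite leqn0 => /eqP->.
rewrite leq_eqVlt => /orP[/eqP->//|/IHn sub] e /sub; have [_ _ _ + _] := run_step n; exact.
Qed.

Lemma run_cls n i : (i < n)%N -> cls (st n) i = req_class i.
Proof. by move=> /run_stable[eL _ _]; rewrite /cls eL. Qed.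

Lemma tree_length n :
  seq_length d pt (tree (st n)) <= 3 * \sum_(i < n | req_hub i) 2 ^+ req_class i.
Proof.
have [fS _] := run_inv n; apply: le_trans (le_trans _ (tree_cost fS)) _.
  by rewrite lerDl mulr_ge0 // sumr_ge0 // => i _; rewrite exprn_ge0.
rewrite big_mkcond [in leRHS]big_mkcond.
rewrite -(big_mkord predT (fun i => if req_hub i then 2 ^+ req_class i else 0)).
rewrite ler_pM2l // le_eqVlt; apply/orP; left; apply/eqP/eq_big_nat => i /andP[_ i_n].
by rewrite run_cls //; have [_ _ ->] := run_stable i_n.
Qed.

Lemma lev_spec n :
  match req_level n with
  | None => seq_length d pt (rented (st n.+1)) = 0
  | Some h => [/\ seq_length d pt (rented (st n.+1)) <= 4 * 2 ^+ h,
      2 ^+ h / 2 <= D (n, false) (n, true)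
    & forall i, (i < n)%N -> req_hub i -> (h <= req_class i)%N ->
        2 ^+ h <= d (req_point n) (req_point i)]
  end.
Proof.
have [fS sS] := run_inv n; have [eL eS eR _ _] := run_step n.
have := charge_level d_metric d_ge1 fS sS; rewrite /req_level eL eR.
case: (level _ n) => [h [h1 h2 h3]|//]; split=> // i i_n hi hc.
have [_ e2 e3] := run_stable i_n.
by rewrite /req_point -e2 /site eS; apply: h3; rewrite ?e3 ?run_cls.
Qed.

Lemma run_connects n :
  connects (edge_set pt (tree (st n.+1)) :|: edge_set pt (rented (st n.+1)))
    (pt (n, false)) (pt (n, true)).
Proof.
have [fS sS] := run_inv n; have [_ _ eR sT _] := run_step n.
have := charge_connects d_metric fS sS; apply: connects_sub; rewrite eR.
by apply: setSU; apply: edge_set_sub.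
Qed.

Lemma run_lt n e : e \in tree (st n.+1) ++ rented (st n.+1) ->
  (e.1.1 < n.+1)%N && (e.2.1 < n.+1)%N.
Proof.
have [fS1 _] := run_inv n.+1; have [fS _] := run_inv n; have [_ _ -> _ _] := run_step n.
by rewrite mem_cat => /orP[/(tree_lt fS1) | /(charge_rented_lt fS)].
Qed.

Definition witness n i :=
  [&& (i <= n)%N, req_level i == req_level n
    & d (req_point i) (req_point n) < 2 ^+ req_class n / 2].

Lemma req_hubE n : req_hub n = req_level n && (theta <= (count (witness n) (iota 0 n.+1))%:R).
Proof.
have [eL eS _ _ eH] := run_step n; rewrite /req_hub eH eqxx /req_level eL; congr (_ && (_ <= _%:R)).
apply: eq_in_count => i; rewrite mem_iota add0n ltnS => /andP[_ i_n]; rewrite /witness i_n.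
have e1 : level (charge D n (st n)) i = req_level i.
  by rewrite -eL; have [] := @run_stable n.+1 i i_n.
have e2 : site (charge D n (st n)) i = site (st i.+1) i.
  by rewrite /site -eS; have [] := @run_stable n.+1 i i_n.
have e3 : level (charge D n (st n)) n = req_level n by rewrite /req_level eL.
have e4 : site (charge D n (st n)) n = site (st n.+1) n by rewrite /site eS.
by rewrite e1 e2 /cls e3 e4.
Qed.

(** Double counting of hubs and their witnesses: each hub has at least [theta] witnesses of its own
    class, and each charge is a witness of at most one hub. *)
Lemma hub_cost n :
  theta * \sum_(i < n | req_hub i) 2 ^+ req_class i <= \sum_(i < n | req_level i) 2 ^+ req_class i.
Proof.
pose P (i j : 'I_n) := witness i j.
apply: (@le_trans _ _ (\sum_(i < n | req_hub i) \sum_(j < n | P i j) 2 ^+ req_class j)).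
  rewrite mulr_sumr; apply: ler_sum => i; rewrite req_hubE => /andP[_ wi].
  have -> : \sum_(j < n | P i j) 2 ^+ req_class j =
      (\sum_(j < n | P i j) 1) * 2 ^+ req_class i :> R.
    by rewrite mulr_suml; apply: eq_bigr => j /and3P[_ /eqP ij _]; rewrite mul1r /req_class ij.
  rewrite ler_pM2r ?exprn_gt0 //; apply: le_trans wi _.
  have -> : \sum_(j < n | P i j) 1 = (\sum_(j < n | P i j) 1)%N%:R :> R by rewrite natr_sum.
  rewrite ler_nat -(big_mkord (witness i) (fun=> 1%N)) sum1_count.
  by rewrite /index_iota subn0 -[X in (_ <= count _ (iota _ X))%N](subnKC (ltn_ord i))
    iotaD count_cat leq_addr.
rewrite (exchange_big_dep (fun j : 'I_n => req_level j)) /=; last first.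
  by move=> i j; rewrite req_hubE => /andP[li _] /and3P[_ /eqP-> _].
apply: ler_sum => j lj.
case: (pickP (fun i : 'I_n => req_hub i && P i j)) => [i0 Pi0|no_i]; last first.
  by rewrite big_pred0 // exprn_ge0.
rewrite (big_pred1 i0) // => i; apply/idP/eqP => [Pi|-> //]; apply/eqP.
(* Through the common witness the two hubs are closer than [2 ^+ h], whereas the later one was
   charged at distance at least [2 ^+ h] from the earlier one. *)
have lt_contra (i1 i2 : 'I_n) : req_hub i1 && P i1 j -> req_hub i2 && P i2 j -> ~ (i1 < i2)%N.
  move=> /andP[h1 /and3P[_ /eqP e1 d1]] /andP[h2 /and3P[_ /eqP e2 d2]] i12.
  have e12 : req_level i2 = req_level i1 by rewrite -e1.
  have := lev_spec i2; rewrite /req_class -e1 in d1; rewrite /req_class -e2 in d2.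
  case lj': (req_level j) lj => [h|//] _; rewrite -e2 lj' => -[_ _ /(_ i1 i12 h1)].
  rewrite /req_class -e1 lj' /= => /(_ (leqnn h)); rewrite leNgt => /negP; apply.
  case: d_metric => _ dC dT; have := dT (req_point i2) (req_point j) (req_point i1).
  rewrite (dC (req_point i2) (req_point j)).
  by move: d1 d2; rewrite lj' /=; lra.
by apply/eqP/val_inj/eqP; case: ltngtP => // lt; case: (lt_contra _ _ _ _ lt).
Qed.

(** The constant is 3 for the tree, by [tree_length] and [hub_cost], plus 4 for the rent. *)
Lemma run_cost n :
  theta * seq_length d pt (tree (st n)) + \sum_(i < n) seq_length d pt (rented (st i.+1))
  <= 7 * \sum_(i < n | req_level i) 2 ^+ req_class i.
Proof.
have th0 : 0 <= theta by apply: le_trans theta_ge1.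
have tr := ler_wpM2l th0 (tree_length n); have hc := hub_cost n.
have rc : \sum_(i < n) seq_length d pt (rented (st i.+1)) <=
    4 * \sum_(i < n | req_level i) 2 ^+ req_class i.
  rewrite mulr_sumr [leRHS]big_mkcond; apply: ler_sum => i _; have := lev_spec i.
  by rewrite /req_class; case: (req_level i) => [h []|->].
move: tr hc rc; rewrite mulrCA; set x := \sum_(_ < _ | req_level _) _; set y := \sum_(_ < _ | _) _.
lra.
Qed.

Lemma cluster_count n h (C : pred V) :
  (forall u v, C u -> C v -> d u v < 2 ^+ h / 2) ->
  (count (fun i => (req_level i == Some h) && C (req_point i)) (iota 0 n))%:R <= theta + 1.
Proof.
move=> diam; set X := fun i => _.
(* Strengthened for the induction: as long as no hub of scale [h] lies in [C], the count is even
   below [theta]. *)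
suff : (count X (iota 0 n))%:R <= theta + 1 /\
    ((count X (iota 0 n))%:R < theta \/ exists i, [/\ (i < n)%N, X i & req_hub i]) by case.
elim: n => [|n [IH1 IH2]]; first by rewrite /=; split; [|left]; move: theta_ge1; lra.
rewrite -addn1 iotaD count_cat /= add0n addn0.
case Xn: (X n); rewrite ?addn1 ?addn0; last first.
  by split=> //; case: IH2 => [|[i [i_n Xi hi]]]; [left | right; exists i; rewrite leqW].
(* A hub already in [C] would keep the new charge at distance [2 ^+ h], more than the diameter
   allows. So at most one charge follows a count below [theta]. *)
have {IH2} lt_th : (count X (iota 0 n))%:R < theta.
  case: IH2 => // -[i [i_n /andP[/eqP li Ci] hi]]; case/andP: Xn => /eqP ln Cn.
  have := lev_spec n; rewrite ln => -[_ _ /(_ i i_n hi)]; rewrite /req_class li => /(_ (leqnn h)).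
  have := diam _ _ Cn Ci; have : 0 < (2 : R) ^+ h by rewrite exprn_gt0.
  by lra.
split; first by rewrite -addn1 natrD; lra.
case: (ltP _ theta) => [?|le_th]; [by left | right; exists n; split=> //].
case/andP: Xn => /eqP ln Cn; rewrite req_hubE ln andTb; apply: le_trans le_th _.
rewrite ler_nat -[n.+1]addn1 iotaD count_cat /= add0n addn0.
rewrite -[X in (X <= _)%N]addn1 leq_add //; last first.
  by rewrite /witness leqnn eqxx /req_class ln /=; rewrite diam.
rewrite -!size_filter uniq_leq_size ?filter_uniq ?iota_uniq // => i.
rewrite !mem_filter => /andP[/andP[/eqP li Ci]]; rewrite mem_iota => /andP[_ i_n].
by rewrite /witness (ltnW i_n) li ln eqxx /req_class ln /= diam // mem_iota.
Qed.

End Run.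

(** * Random padded partitions *)

Section StepFunctions.
Variable R : realFieldType.
Implicit Types (x l u : R) (s : seq R).

(* The integral over [[x, last x s]] of the step function equal to [f q] on each
   [(p, q]], for [p] and [q] consecutive in [x :: s]. *)
Fixpoint gaps (f : R -> R) x s : R :=
  if s is q :: s' then (q - x) * f q + gaps f q s' else 0.

Lemma gaps_ge0 f x s : path <=%R x s -> (forall q, 0 <= f q) -> 0 <= gaps f x s.
Proof.
move=> + f0; elim: s x => //= q s IHs x /andP[xq qs].
by rewrite addr_ge0 ?IHs // mulr_ge0 // subr_ge0.
Qed.

Lemma gaps_sum (J : finType) (w : J -> R) (f : J -> R -> R) x s :
  gaps (fun q => \sum_j w j * f j q) x s = \sum_j w j * gaps (f j) x s.
Proof.
elim: s x => [|q s IHs] x /=; first by rewrite big1 // => j _; rewrite mulr0.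
rewrite IHs mulr_sumr -big_split; apply: eq_bigr => j _ /=; ring.
Qed.

Lemma gaps_eq0 x s u : all (> u) s -> gaps (fun q => (q <= u)%R%:R) x s = 0.
Proof.
elim: s x => //= q s IHs x /andP[uq us].
by rewrite IHs // leNgt uq mulr0 addr0.
Qed.

Lemma gaps_le x s u : path <=%R x s -> u \in x :: s ->
  gaps (fun q => (q <= u)%R%:R) x s = u - x.
Proof.
elim: s x => [|q s IHs] x; first by rewrite mem_seq1 => _ /eqP->; rewrite subrr.
move=> /= /andP[xq qs]; have := order_path_min le_trans qs => /allP q_min.
have [uqs _|] := boolP (u \in q :: s).
  have qu : q <= u by move: uqs; rewrite inE => /orP[/eqP->//|/q_min].
  by rewrite IHs // qu mulr1; ring.
rewrite inE negb_or => /andP[uq us]; rewrite !inE (negPf uq) (negPf us) !orbF => /eqP ux.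
have ltuq : u < q by rewrite lt_neqAle uq ux.
rewrite leNgt ltuq mulr0 add0r gaps_eq0 ?ux ?subrr //.
apply/allP=> r /q_min; rewrite -ux; exact: lt_le_trans.
Qed.

(** A pointwise nonnegative combination of indicators of intervals has nonnegative integral. With
    all interval ends as breakpoints, [gaps] computes this integral exactly as a finite sum. *)
Lemma step_integral_ge0 (J : finType) (w l u : J -> R) : (forall j, l j <= u j) ->
  (forall r, 0 <= \sum_j w j * (l j < r <= u j)%R%:R) ->
  0 <= \sum_j w j * (u j - l j).
Proof.
move=> lu reqpos; pose s := sort <=%R ([seq l j | j <- enum J] ++ [seq u j | j <- enum J]).
have ls j : l j \in s by rewrite mem_sort mem_cat map_f ?mem_enum.
have us j : u j \in s by rewrite mem_sort mem_cat orbC map_f ?mem_enum.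
have : sorted <=%R s by apply: sort_le_sorted.
case: s ls us => [|x s] ls us.
  by move=> _; rewrite big1 // => j; have := ls j; rewrite in_nil.
move=> /= xs; have := gaps_ge0 xs reqpos; rewrite gaps_sum.
rewrite (eq_bigr (fun j => w j * (u j - l j))) // => j _; congr (_ * _).
(* The indicator of [l j < q <= u j] is the indicator of [q <= u j] minus that of [q <= l j]. *)
have -> : u j - l j = (u j - x) - (l j - x) by ring.
rewrite -(gaps_le xs (us j)) -(gaps_le xs (ls j)).
elim: (s) (x) => [|q s' IHs] y /=; first by rewrite subrr.
rewrite IHs ltNge; case: (leP q (l j)) => [/le_trans/(_ (lu j)) ->|_] /=; ring.
Qed.

(** The difference of the two sides is one combination of indicators indexed by [I + J], with weight
    -1 on the part of [I] selected by [P]. *)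
Lemma step_integral_le (I J : finType) (P : pred I) (a b : I -> R) (w l u : J -> R) :
  (forall i, a i <= b i) -> (forall j, l j <= u j) ->
  (forall r, \sum_(i | P i) (a i < r <= b i)%R%:R <= \sum_j w j * (l j < r <= u j)%R%:R) ->
  \sum_(i | P i) (b i - a i) <= \sum_j w j * (u j - l j).
Proof.
move=> ab lu le_r.
pose w' (k : I + J) := match k with inl i => if P i then -1 else 0 | inr j => w j end.
pose l' (k : I + J) := match k with inl i => a i | inr j => l j end.
pose u' (k : I + J) := match k with inl i => b i | inr j => u j end.
have split_sum (f : I + J -> R) : \sum_k w' k * f k =
    - (\sum_(i | P i) f (inl i)) + \sum_j w j * f (inr j).
  rewrite big_sumType /=; congr (_ + _); rewrite -sumrN [RHS]big_mkcond.
  by apply: eq_bigr => i _; case: (P i); rewrite ?mulN1r ?mul0r.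
have := @step_integral_ge0 _ w' l' u'; rewrite split_sum addrC subr_ge0; apply.
  by case.
by move=> r; rewrite (split_sum (fun k => (l' k < r <= u' k)%R%:R)) addrC subr_ge0.
Qed.

End StepFunctions.

(** * First element of a set under a uniformly random permutation *)

Section RandomFirst.
Variable V : finType.
Implicit Types (p : {perm V}) (A : {set V}).

Definition prio p x : nat := enum_rank (p x).

Lemma prio_inj p : injective (prio p).
Proof. by move=> x y /val_inj /enum_rank_inj /perm_inj. Qed.

Definition first_in p A x := (x \in A) && [forall (y | y \in A), (prio p x <= prio p y)%N].

Lemma first_in_inj p A x y : first_in p A x -> first_in p A y -> x = y.
Proof.
move=> /andP[xA /forall_inP xm] /andP[yA /forall_inP ym].
by apply: (@prio_inj p); apply/eqP; rewrite eqn_leq xm ?ym.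
Qed.

Lemma first_in_ex p A : A != set0 -> exists x, first_in p A x.
Proof.
case/set0Pn=> x0 x0A; case: (arg_minnP (prio p) x0A) => x xA xm.
by exists x; apply/andP; split=> //; apply/forall_inP.
Qed.

(** Composing with the transposition of [x] and [y] injects the permutations with [x] first into
    those with [y] first, and every permutation has at most one first element in [A]. *)
Lemma card_first_in A x : x \in A ->
  (#|[set p | first_in p A x]| * #|A| <= #|{perm V}|)%N.
Proof.
move=> xA.
have le_card y : y \in A -> (#|[set p | first_in p A x]| <= #|[set p | first_in p A y]|)%N.
  move=> yA; rewrite -(card_imset _ (@mulgI _ (tperm x y))).
  apply: subset_leq_card; apply/subsetP=> q /imsetP[p]; rewrite !inE => /andP[_ /forall_inP pm] ->.
  rewrite /first_in yA; apply/forall_inP => z zA; rewrite /prio !permM tpermR.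
  by apply: pm; case: tpermP.
apply: (@leq_trans (\sum_(y in A) #|[set p | first_in p A y]|)).
  by rewrite mulnC -sum_nat_const; apply: leq_sum.
have -> : (\sum_(y in A) #|[set p | first_in p A y]| = \sum_p \sum_(y | first_in p A y) 1)%N.
  rewrite (exchange_big_dep (fun y => y \in A)) /=; last by move=> p y _ /andP[].
  by apply: eq_bigr => y yA; rewrite -sum1_card; apply: eq_bigl => p; rewrite inE.
rewrite -sum1_card; apply: leq_sum => p _; rewrite sum1_card.
apply/card_le1P => y; rewrite unfold_in => fy z; rewrite unfold_in inE.
by apply/idP/eqP => [fz|->//]; apply: first_in_inj fz fy.
Qed.

End RandomFirst.

(** * Clusters around random centres and the probability of cutting a pair *)

Section Decomposition.
Variables (R : realType) (V : finType) (d : V -> V -> R) (T : {set V}).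
Hypothesis d_metric : is_metric d.

Definition ball (r : R) v : {set V} := [set x in T | d x v < r].

Definition center p r v : option V := [pick x | first_in p (ball r v) x].

Definition dmin u v x := Num.min (d x u) (d x v).
Definition dmax u v x := Num.max (d x u) (d x v).

(* The position of [x] when the points of [T] are sorted by distance to [{u, v}]. *)
Definition rank u v x : nat := #|[set y in T | dmin u v y <= dmin u v x]|.

Lemma center_ball p r v x : center p r v = Some x -> x \in T /\ d x v < r.
Proof.
rewrite /center; case: pickP => // y /andP[+ _] [<-].
by rewrite inE => /andP[].
Qed.

Lemma center_some p r v : 0 < r -> v \in T -> center p r v != None.
Proof.
move=> r0 vT; rewrite /center; case: pickP => // no.
have [|x fx] := @first_in_ex V p (ball r v); last by rewrite no in fx.
by apply/set0Pn; exists v; rewrite inE vT; case: d_metric => /(_ v v)[_ ->].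
Qed.

Lemma center_diam p r u v x :
  center p r u == Some x -> center p r v == Some x -> d u v < 2 * r.
Proof.
move=> /eqP/center_ball[_ xu] /eqP/center_ball[_ xv].
case: d_metric => _ dC dT; have := dT u x v; rewrite (dC u x); lra.
Qed.

Lemma center_first p r v x : first_in p (ball r v) x -> center p r v = Some x.
Proof.
move=> fx; rewrite /center; case: pickP => [y fy|/(_ x)]; last by rewrite fx.
by rewrite (first_in_inj fx fy).
Qed.

Lemma dmin_le_dmax u v x : dmin u v x <= dmax u v x.
Proof. by rewrite /dmin /dmax ge_min le_max lexx. Qed.

Lemma dmax_sub_dmin u v x : dmax u v x - dmin u v x <= d u v.
Proof.
case: d_metric => _ dC dT; rewrite /dmax /dmin; case: (leP (d x u) (d x v)) => _.
  by rewrite lerBlDl.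
by rewrite lerBlDl (dC u).
Qed.

(* The first centre reaching [u] or [v] cuts them apart only if it misses one of them. *)
Lemma center_cut p r u v : center p r u != center p r v ->
  exists2 x, first_in p (ball r u :|: ball r v) x & dmin u v x < r <= dmax u v x.
Proof.
move=> cuv; have [|x fx] := @first_in_ex V p (ball r u :|: ball r v).
  apply: contraNneq cuv => /eqP; rewrite setU_eq0 => /andP[/eqP e1 /eqP e2].
  by rewrite /center e1 e2.
exists x => //; have {fx} /andP[xU /forall_inP x_first] := fx.
have sub w : (w == u) || (w == v) -> x \in ball r w -> center p r w = Some x.
  move=> wuv xw; apply: center_first; rewrite /first_in xw; apply/forall_inP => y yw.
  by apply: x_first; rewrite inE; case/orP: wuv => /eqP <-; rewrite yw ?orbT.
have xT : x \in T by move: xU; rewrite !inE; case/orP=> /andP[].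
rewrite /dmin /dmax gt_min le_max; move: xU sub; rewrite !inE xT /=.
case: (ltP (d x u)) => [xu|xu]; case: (ltP (d x v)) => [xv|xv] //= _ sub.
by rewrite !sub ?eqxx ?orbT ?inE ?xT // in cuv.
Qed.

(** By [center_cut], a cut is caused by some [x] that comes first in the union of the two balls.
    This union contains all points of rank up to that of [x], so [x] is first with probability at
    most the inverse of its rank. *)
Lemma prob_cut r u v :
  (#|[set p | center p r u != center p r v]|)%:R / #|{perm V}|%:R
  <= \sum_(x in T) (rank u v x)%:R^-1 * (dmin u v x < r <= dmax u v x)%R%:R :> R.
Proof.
have n0 : 0 < #|{perm V}|%:R :> R by rewrite ltr0n; apply/card_gt0P; exists 1%g.
set U := ball r u :|: ball r v.
rewrite ler_pdivrMr // mulr_suml.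
apply: (@le_trans _ _ (\sum_(x in T) (#|[set p | first_in p U x]|)%:R *
                        (dmin u v x < r <= dmax u v x)%R%:R)).
  rewrite -sum1_card natr_sum.
  under [leRHS]eq_bigr do rewrite -sum1_card natr_sum mulr_suml.
  rewrite (exchange_big_dep predT) //= big_mkcond /=; apply: ler_sum => p _.
  rewrite inE; case: ifP => [|_]; last first.
    by apply: sumr_ge0 => x _; rewrite mulr_ge0.
  move=> /center_cut[x fx rx].
  have xT : x \in T by case/andP: fx; rewrite !inE => /orP[] /andP[].
  rewrite (bigD1 x) /=; last by rewrite xT inE.
  by rewrite rx mulr1 lerDl sumr_ge0 // => y _; rewrite mulr_ge0.
apply: ler_sum => x xT.
case: (boolP (dmin u v x < r <= dmax u v x)) => [/andP[rx _]|_]; last by rewrite !mulr0 mul0r.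
rewrite !mulr1.
have rank_gt0 : (0 < rank u v x)%N by apply/card_gt0P; exists x; rewrite inE xT lexx.
rewrite mulrC ler_pdivlMr ?ltr0n // -natrM ler_nat.
have xU : x \in U by move: rx; rewrite /dmin gt_min !inE xT.
apply: leq_trans (card_first_in xU); rewrite leq_mul2l; apply/orP; right.
apply: subset_leq_card; apply/subsetP=> y; rewrite !inE => /andP[-> /le_lt_trans/(_ rx)].
by rewrite /dmin gt_min.
Qed.

End Decomposition.

(** A point maximising [f] has rank [#|T|]; removing it can only decrease the other ranks. Ties
    share the larger rank, hence an inequality. *)
Lemma sum_inv_rank (R : realType) (V : finType) (f : V -> R) (T : {set V}) :
  \sum_(x in T) (#|[set y in T | f y <= f x]|)%:R^-1 <= \sum_(i < #|T|) i.+1%:R^-1 :> R.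
Proof.
move: {-1}#|T| (erefl #|T|) => n; elim: n T => [|n IHn] T Tn.
  by rewrite (cards0_eq Tn) big_set0 big_ord0.
have [x0 x0T] : exists x, x \in T by apply/card_gt0P; rewrite Tn.
have [x xT' xmax] := arg_maxP f x0T; have xT : x \in T := xT'.
rewrite (big_setD1 x xT) big_ord_recr /= addrC lerD //; last first.
  suff -> : [set y in T | f y <= f x] = T by rewrite Tn.
  by apply/setP=> y; rewrite inE; apply: andb_idr => /xmax.
have Tx : #|T :\ x| = n by move: (cardsD1 x T); rewrite xT Tn add1n => -[<-].
apply: le_trans (IHn _ Tx).
apply: ler_sum => y; rewrite !inE => /andP[yx yT]; rewrite lef_pV2 ?posrE ?ltr0n ?ler_nat.
- by apply: subset_leq_card; apply/subsetP=> z; rewrite !inE => /andP[/andP[_ ->] ->].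
- by apply/card_gt0P; exists y; rewrite inE yT lexx.
- by apply/card_gt0P; exists y; rewrite !inE yx yT lexx.
Qed.

(** Each new term is bounded by an increment of [ln], using [ln (1 + x) <= x] at
    [x = - n.+2%:R^-1]. *)
Lemma harmonic_le_ln (R : realType) n : \sum_(i < n.+1) i.+1%:R^-1 <= 1 + ln n.+1%:R :> R.
Proof.
elim: n => [|n IHn]; first by rewrite big_ord1 ln1 addr0 invr1.
rewrite big_ord_recr /=; apply: le_trans (lerD IHn (lexx _)) _.
rewrite -addrA lerD2l.
have n1 : (0 : R) < n.+1%:R by rewrite ltr0n.
have n2 : (0 : R) < n.+2%:R by rewrite ltr0n.
have := @le_ln1Dx R (- n.+2%:R^-1).
rewrite ltrN2 invf_lt1 // ltr1n => /(_ isT).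
have -> : 1 + - n.+2%:R^-1 = n.+1%:R / n.+2%:R :> R.
  apply: (mulIf (lt0r_neq0 n2)); rewrite divfK ?lt0r_neq0 //.
  by rewrite mulrDl mul1r mulNr mulVf ?lt0r_neq0 // -[n.+2]addn1 natrD addrK.
by rewrite ln_div ?posrE // lerBlDr [- _ + _]addrC lerBrDr.
Qed.

Lemma ln2_ge (R : realType) : 1 / 2 <= ln 2 :> R.
Proof.
have := @le_ln1Dx R (- (1 / 2)).
rewrite (_ : 1 + - (1 / 2) = 2^-1 :> R); last by lra.
by rewrite lnV ?posrE // => /(_ _); lra.
Qed.

(** * Charging an offline solution *)

Section Charging.
Variables (R : realType) (V : finType) (d : V -> V -> R) (pt : reqpos -> V) (theta : R).
Hypothesis d_metric : is_metric d.
Hypothesis d_ge1 : forall u v, u != v -> 1 <= d u v.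
Hypothesis theta_ge1 : 1 <= theta.

Local Notation req_level := (req_level d pt theta).
Local Notation req_class := (req_class d pt theta).
Local Notation req_point := (req_point d pt theta).

Variables (n : nat) (T : {set V}) (H : {set {set V}}) (Q : 'I_n -> {set {set V}}).
Hypothesis T_pt : forall (i : 'I_n) b, pt (val i, b) \in T.
Hypothesis H_edges : H \subset complete_edges V.
Hypothesis Q_edges : forall i, Q i \subset complete_edges V.
Hypothesis HQ_connects :
  forall i : 'I_n, connects (H :|: Q i) (pt (val i, false)) (pt (val i, true)).

Local Notation center := (center d T).

(** A fixed orientation of each edge; the default value is meaningless and only reached on sets that
    are not of the form [[set x; y]]. *)
Definition ends (e : {set V}) : V * V :=
  let x0 := pt (0%N, false) in odflt (x0, x0) [pick q | e == [set q.1; q.2]].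

Lemma endsE e : e \in complete_edges V -> e = [set (ends e).1; (ends e).2].
Proof.
rewrite inE /ends => /cards2P[x [y [xy eE]]].
case: (pickP (fun q : V * V => e == [set q.1; q.2])) => [q /eqP //|/(_ (x, y))].
by rewrite eE eqxx.
Qed.

Lemma ends_cut (P : pred V) a b : [set a; b] \in complete_edges V -> P a -> ~~ P b ->
  P (ends [set a; b]).1 != P (ends [set a; b]).2.
Proof.
move=> /endsE; set u := (ends _).1; set v := (ends _).2 => eE Pa nPb.
have : a \in [set u; v] by rewrite -eE set21.
have : b \in [set u; v] by rewrite -eE set22.
rewrite !inE => /orP[] /eqP eb /orP[] /eqP ea; move: Pa nPb; rewrite ea eb => Pa.
- by rewrite Pa.
- by rewrite Pa => /negPf->.
- by rewrite Pa => /negPf->.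
- by rewrite Pa.
Qed.

(** The price per unit length that the offline solution pays for [e], with [theta] as the buying
    price. *)
Definition weight e : R := theta * (e \in H)%:R + \sum_i (e \in Q i)%:R.

Lemma weight_ge0 e : 0 <= weight e.
Proof.
have th0 : 0 <= theta by apply: le_trans theta_ge1.
by rewrite addr_ge0 ?mulr_ge0 // sumr_ge0.
Qed.

Lemma sum_weight (f : {set V} -> R) :
  \sum_e weight e * f e = theta * \sum_(e in H) f e + \sum_i \sum_(e in Q i) f e.
Proof.
have indic (F : {set {set V}}) : \sum_e (e \in F)%:R * f e = \sum_(e in F) f e.
  by rewrite [RHS]big_mkcond; apply: eq_bigr => e _; case: ifP; rewrite ?mul1r ?mul0r.
under eq_bigr do rewrite mulrDl -mulrA mulr_suml.
rewrite big_split /= -mulr_sumr indic; congr +%R.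
by rewrite exchange_big; apply: eq_bigr => i _; apply: indic.
Qed.

Definition cuts p r x e :=
  (center p r (ends e).1 == Some x) != (center p r (ends e).2 == Some x).

(** An edge leaves at most the two clusters that contain its ends. *)
Lemma sum_cuts p r e :
  \sum_x (cuts p r x e)%:R <= 2 * (center p r (ends e).1 != center p r (ends e).2)%:R :> R.
Proof.
rewrite /cuts; set a := center _ _ _; set b := center _ _ _.
case: (eqVneq a b) => [->|_].
  by rewrite big1 ?mulr0 // => x _; rewrite eqxx.
have one (c : option V) : \sum_x (c == Some x)%:R <= 1 :> R.
  case: c => [y|]; last by rewrite big1.
  rewrite (bigD1 y) //= eqxx big1 ?addr0 // => x xy.
  by case: eqP => // -[yx]; rewrite yx eqxx in xy.
rewrite mulr1; apply: (@le_trans _ _ (\sum_x ((a == Some x)%:R + (b == Some x)%:R))).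
  by apply: ler_sum => x _; case: (a == _); case: (b == _) => /=; lra.
by rewrite big_split /= -[2]/(1 + 1) lerD.
Qed.

Lemma req_point_pt i : exists b, req_point i = pt (i, b).
Proof. by exists (side (run theta (fun p q => d (pt p) (pt q)) i.+1) i). Qed.

(** If a bought edge leaves the cluster, its weight is at least [theta], and [cluster_count] allows
    at most [theta + 1 <= 2 * theta] charges. Otherwise every request charged in the cluster must
    rent an edge leaving it. *)
Lemma cluster_charge p h r x : 0 < r -> r <= 2 ^+ h / 4 ->
  (#|[set i : 'I_n | (req_level i == Some h) && (center p r (req_point i) == Some x)]|)%:R
  <= 2 * \sum_e weight e * (cuts p r x e)%:R.
Proof.
move=> r0 rh; set X := [set i | _].
have S_ge0 (F : {set {set V}}) : 0 <= \sum_(e in F) (cuts p r x e)%:R :> R by apply: sumr_ge0.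
have th0 : 0 <= theta by apply: le_trans theta_ge1.
rewrite sum_weight.
have [eX0|[i0 i0X]] := set_0Vmem X.
  by rewrite eX0 cards0 mulr_ge0 // addr_ge0 ?mulr_ge0 // sumr_ge0.
pose C v := center p r v == Some x.
have diamC u v : C u -> C v -> d u v < 2 ^+ h / 2.
  by move=> Cu Cv; have := center_diam d_metric Cu Cv; move: rh; lra.
case: (boolP [exists e in H, cuts p r x e]) => [/exists_inP[e eH ce]|].
  have cnt := cluster_count pt d_metric d_ge1 theta_ge1 n diamC.
  have XE : #|X| = count (fun i => (req_level i == Some h) && C (req_point i)) (iota 0 n).
    have -> : iota 0 n = index_iota 0 n by rewrite /index_iota subn0.
    rewrite -sum1_count big_mkord -sum1_card.
    by apply: eq_bigl => i; rewrite inE.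
  have : 1 <= \sum_(e in H) (cuts p r x e)%:R :> R.
    by rewrite (bigD1 e) //= ce lerDl sumr_ge0.
  have : 0 <= \sum_i \sum_(e in Q i) (cuts p r x e)%:R :> R by apply: sumr_ge0.
  rewrite -XE in cnt; move: cnt theta_ge1; set y := \sum_i _; set z := \sum_(e in H) _.
  by nra.
move=> /exists_inPn noH.
have X_le : #|X|%:R <= \sum_i \sum_(e in Q i) (cuts p r x e)%:R :> R.
  rewrite -sum1_card natr_sum big_mkcond; apply: ler_sum => i _.
  case: ifP => [|_]; last exact: sumr_ge0.
  rewrite inE => /andP[/eqP li Ci].
  suff [e eQ ce] : exists2 e, e \in Q i & cuts p r x e.
    by rewrite (bigD1 e) //= ce lerDl sumr_ge0.
  have far := lev_spec pt theta d_metric d_ge1 i.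
  rewrite li in far; case: far => _ far _.
  (* The charged endpoint is in the cluster; the other is at distance at least [2 ^+ h / 2], beyond
     the diameter, hence outside. *)
  have [u [v [Cu nCv uv]]] : exists u v, [/\ C u, ~~ C v & connects (H :|: Q i) u v].
    have both : ~ (C (pt (val i, false)) /\ C (pt (val i, true))).
      by case=> C1 C2; have := diamC _ _ C1 C2; rewrite ltNge far.
    have [[] e] := req_point_pt i; rewrite e in Ci; [exists (pt (val i, true)), (pt (val i, false))|
      exists (pt (val i, false)), (pt (val i, true))]; split=> //.
    - by apply/negP => C2; apply: both.
    - by rewrite connects_sym.
    - by apply/negP => C2; apply: both.
  have [a [b [ab Ca nCb]]] := connects_cut uv Cu nCv.
  have abE : [set a; b] \in complete_edges V.
    by move: ab; rewrite inE => /orP[]; apply: (subsetP _).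
  have cab : cuts p r x [set a; b] by apply: (ends_cut abE Ca nCb).
  exists [set a; b] => //; move: ab; rewrite inE => /orP[/noH|//].
  by rewrite cab.
have := S_ge0 H; have := ler0n R #|X|; move: X_le.
set y := \sum_i _; set z := \sum_(e in H) _ => le_y X0 z0.
by have := mulr_ge0 th0 z0; lra.
Qed.

(** Sum of [cluster_charge] over the clusters, which contain all charged points since these are
    terminals and [r] is positive. One factor 2 comes from each cluster, the other from the two
    clusters at the ends of an edge. *)
Lemma level_charge p h r : 0 < r -> r <= 2 ^+ h / 4 ->
  (#|[set i : 'I_n | req_level i == Some h]|)%:R
  <= 4 * \sum_e weight e * (center p r (ends e).1 != center p r (ends e).2)%:R.
Proof.
move=> r0 rh.
have -> : #|[set i : 'I_n | req_level i == Some h]|%:R =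
    \sum_x (#|[set i : 'I_n | (req_level i == Some h) &&
                              (center p r (req_point i) == Some x)]|)%:R :> R.
  rewrite -natr_sum; congr _%:R; rewrite -sum1_card.
  under [RHS]eq_bigr do rewrite -sum1_card.
  rewrite (exchange_big_dep (fun i => i \in [set i : 'I_n | req_level i == Some h])) /=; last first.
    by move=> x i _; rewrite !inE => /andP[].
  apply: eq_bigr => i; rewrite inE => li.
  have [b psE] := req_point_pt i.
  have := center_some d_metric p r0 (T_pt i b); rewrite -psE.
  case cE: (center p r (req_point i)) => [y|//] _.
  rewrite (big_pred1 y) // => x; rewrite inE li cE /=; apply/eqP/eqP => [[->//]|->//].
apply: le_trans (ler_sum _ (fun x _ => cluster_charge p x r0 rh)) _.
rewrite -mulr_sumr exchange_big (_ : 4 = 2 * 2) -?mulrA; last by lra.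
rewrite ler_pM2l // mulr_sumr; apply: ler_sum => e _.
by rewrite -mulr_sumr mulrCA ler_wpM2l ?weight_ge0 ?sum_cuts.
Qed.

(** Average of [level_charge] over all permutations; the left side does not depend on [p]. *)
Lemma level_charge_mean h r : 0 < r -> r <= 2 ^+ h / 4 ->
  (#|[set i : 'I_n | req_level i == Some h]|)%:R
  <= \sum_e 4 * weight e * \sum_(x in T) (rank d T (ends e).1 (ends e).2 x)%:R^-1 *
       (dmin d (ends e).1 (ends e).2 x < r <= dmax d (ends e).1 (ends e).2 x)%R%:R.
Proof.
move=> r0 rh; set X := [set i | _].
have n0 : 0 < #|{perm V}|%:R :> R by rewrite ltr0n; apply/card_gt0P; exists 1%g.
have : \sum_(p : {perm V}) #|X|%:R <= \sum_(p : {perm V})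
    4 * \sum_e weight e * (center p r (ends e).1 != center p r (ends e).2)%:R :> R.
  by apply: ler_sum => p _; apply: level_charge.
rewrite sumr_const -[X in X <= _ -> _]mulr_natr -ler_pdivlMr // => /le_trans; apply.
rewrite -mulr_sumr exchange_big /= mulr_sumr mulr_suml; apply: ler_sum => e _.
rewrite -mulr_sumr [4 * (weight e * _)]mulrA -[4 * weight e * _ * _]mulrA.
rewrite ler_wpM2l ?mulr_ge0 ?weight_ge0 //.
apply: le_trans (prob_cut d T r (ends e).1 (ends e).2).
rewrite ler_pM2r ?invr_gt0 // -sum1_card natr_sum [leRHS]big_mkcond /=.
by apply: ler_sum => p _; rewrite inE; case: ifP.
Qed.

(** Integration of [level_charge_mean] over [r]. Each charge of scale [h] is active on an interval
    of length [2 ^+ h / 8], so the constant is [8 * 4]. *)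
Lemma charge_le : \sum_(i < n | req_level i) 2 ^+ req_class i
  <= 32 * (\sum_(i < #|T|) i.+1%:R^-1) * \sum_e weight e * edge_length d e.
Proof.
have exp0 k : 0 < (2 : R) ^+ k by rewrite exprn_gt0.
(* The intervals of different scales are disjoint, so at each radius only one scale is counted and
   the edge weights are used once. *)
have scale_inj k1 k2 (r : R) : 2 ^+ k1 / 8 < r -> r <= 2 ^+ k1 / 4 ->
    2 ^+ k2 / 8 < r -> r <= 2 ^+ k2 / 4 -> k1 = k2.
  have lt_contra j k : (j < k)%N -> (2 : R) ^+ j / 4 <= 2 ^+ k / 8.
    move=> jk; have : (2 : R) ^+ j.+1 <= 2 ^+ k by rewrite ler_eXn2l ?ltr1n.
    by rewrite exprS; lra.
  by case: (ltngtP k1 k2) => // /lt_contra le12 r1 r2 r3 r4; exfalso; lra.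
pose w (q : {set V} * V) : R := if q.2 \in T then
  4 * weight q.1 * (rank d T (ends q.1).1 (ends q.1).2 q.2)%:R^-1 else 0.
pose l (q : {set V} * V) := dmin d (ends q.1).1 (ends q.1).2 q.2.
pose u (q : {set V} * V) := dmax d (ends q.1).1 (ends q.1).2 q.2.
have pairE (f : {set V} * V -> R) : \sum_q w q * f q = \sum_e 4 * weight e *
    \sum_(x in T) (rank d T (ends e).1 (ends e).2 x)%:R^-1 * f (e, x).
  transitivity (\sum_e \sum_x w (e, x) * f (e, x)).
    by rewrite pair_bigA; apply: eq_bigr => -[].
  apply: eq_bigr => e _.
  rewrite mulr_sumr [RHS]big_mkcond; apply: eq_bigr => x _; rewrite /w /=.
  by case: ifP => _; rewrite ?mul0r // mulrA.
have := @step_integral_le R 'I_n _ (fun i : 'I_n => req_level i)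
  (fun i : 'I_n => 2 ^+ req_class i / 8)
  (fun i : 'I_n => 2 ^+ req_class i / 4) w l u.
have -> : \sum_(i < n | req_level i) (2 ^+ req_class i / 4 - 2 ^+ req_class i / 8) =
    8^-1 * \sum_(i < n | req_level i) 2 ^+ req_class i :> R.
  by rewrite mulr_sumr; apply: eq_bigr => i _; move: (2 ^+ _) => z; lra.
rewrite (pairE (fun q => u q - l q)) => step.
have {step} : 8^-1 * \sum_(i < n | req_level i) 2 ^+ req_class i <= \sum_e 4 * weight e *
    \sum_(x in T) (rank d T (ends e).1 (ends e).2 x)%:R^-1 * (u (e, x) - l (e, x)).
  apply: step => [i|q|r]; first by have := exp0 (req_class i); move: (2 ^+ _) => z; lra.
    exact: dmin_le_dmax.
  rewrite (pairE (fun q => (l q < r <= u q)%R%:R)).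
  case: (pickP (fun i : 'I_n =>
    req_level i && (2 ^+ req_class i / 8 < r <= 2 ^+ req_class i / 4))); last first.
    move=> none; rewrite big1 => [|i li]; last by have := none i; rewrite /= li /= => ->.
    apply: sumr_ge0 => e _; rewrite mulr_ge0 ?mulr_ge0 ?weight_ge0 // sumr_ge0 // => x _.
    by rewrite mulr_ge0 ?invr_ge0.
  move=> i0 /andP[li0 /andP[r1 r2]].
  have r0 : 0 < r by apply: lt_trans r1; rewrite divr_gt0.
  apply: le_trans (level_charge_mean r0 r2).
  rewrite -sum1_card natr_sum big_mkcond [leRHS]big_mkcond; apply: ler_sum => i _ /=.
  rewrite inE; case: ifP => [li|_]; last by case: ifP.
  case: (boolP (_ < _ <= _)) => [/andP[s1 s2]|_]; last by case: ifP.
  suff -> : req_level i == Some (req_class i0) by [].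
  rewrite -(scale_inj _ _ _ s1 s2 r1 r2).
  by rewrite /req_class; case: (req_level i) li.
move=> le_sum; rewrite -(@ler_pM2l _ 8^-1) ?invr_gt0 //; apply: le_trans le_sum _.
rewrite (_ : 8^-1 * (32 * _ * _) = 4 * (\sum_(i < #|T|) i.+1%:R^-1) *
  \sum_e weight e * edge_length d e); last by lra.
rewrite mulr_sumr; apply: ler_sum => e _.
have h_ge0 : 0 <= \sum_(i < #|T|) i.+1%:R^-1 :> R by apply: sumr_ge0 => i _; rewrite invr_ge0.
(* Sets that are not edges have weight 0; on the others [ends] returns the true endpoints. *)
have [w0|w_pos] := eqVneq (weight e) 0; first by rewrite w0 mulr0 !mul0r mulr0.
have eE : e \in complete_edges V.
  apply: contraNT w_pos => ne; rewrite /weight.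
  rewrite (contraNF (subsetP H_edges e) ne) mulr0 add0r big1 // => i _.
  by rewrite (contraNF (subsetP (Q_edges i) e) ne).
rewrite mulrACA ler_wpM2l ?mulr_ge0 ?weight_ge0 //.
have -> : edge_length d e = d (ends e).1 (ends e).2 by rewrite {1}(endsE eE) edge_lengthE.
apply: le_trans (_ : \sum_(x in T) (rank d T (ends e).1 (ends e).2 x)%:R^-1 *
   d (ends e).1 (ends e).2 <= _).
  by apply: ler_sum => x _; rewrite ler_wpM2l ?invr_ge0 // dmax_sub_dmin.
by rewrite -mulr_suml ler_wpM2r ?metric_ge0 // sum_inv_rank.
Qed.

End Charging.

(** * Translation to the online model and the competitive ratio *)

Definition request_pos (V : Type) (x0 : V) (r : seq (V * V)) (p : reqpos) : V :=
  let q := nth (x0, x0) r p.1 in if p.2 then q.2 else q.1.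

Definition reqpos_of n (p : position n) : reqpos := (val p.1, p.2).

Definition select n (F : seq (reqpos * reqpos)) : {set position n * position n} :=
  [set e | (reqpos_of e.1, reqpos_of e.2) \in F].

(** The value 0 beyond the known positions is arbitrary: by [eq_run] the first [n] steps never
    depend on it. *)
Definition extend_metric (R : realType) n (f : {ffun position n * position n -> R})
    (p q : reqpos) : R :=
  match insub p.1 : option 'I_n, insub q.1 : option 'I_n with
  | Some i, Some j => f ((i, p.2), (j, q.2))
  | _, _ => 0
  end.

(* For [M < 1] an edge is cheaper to buy than to rent even once. *)
Definition rent_or_buy (R : realType) : online_algorithm R := fun M n f =>
  let S := run (Num.max 1 M) (extend_metric f) n in
  if M < 1 then (select n (tree S ++ rented S), set0)
  else (select n (tree S), select n (rented S)).

Section Bridge.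
Variables (R : realType) (V : finType) (d : V -> V -> R) (M : R) (x0 : V).
Variable r : seq (V * V).
Hypothesis d_metric : is_metric d.
Hypothesis d_ge1 : forall u v, u != v -> 1 <= d u v.

Local Notation pt := (request_pos x0 r).
Local Notation theta := (Num.max 1 M).
Local Notation st n := (run theta (fun p q => d (pt p) (pt q)) n).

Lemma endpointE k (p : position (size (take k r))) : endpoint p = pt (reqpos_of p).
Proof.
have p_lt := ltn_ord p.1; rewrite /endpoint /request_pos /= (tnth_nth (x0, x0)) /=.
by rewrite nth_take // (leq_trans p_lt) // size_take_min geq_minl.
Qed.

Lemma run_submetric k : run theta (extend_metric (submetric d (take k r))) (size (take k r)) =
  st (size (take k r)).
Proof.
apply: eq_run => p q p_lt q_lt; rewrite /extend_metric.
by rewrite !insubT /submetric ffunE !endpointE /reqpos_of /= -!surjective_pairing.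
Qed.

Lemma edges_at_select k F :
  (forall e, e \in F -> (e.1.1 < size (take k r))%N && (e.2.1 < size (take k r))%N) ->
  edges_at (select (size (take k r)) F) = edge_set pt F.
Proof.
move=> F_lt; apply/setP=> e; rewrite inE; apply/imsetP/mapP => [[p]|[p]].
  rewrite !inE !endpointE => /andP[pF pn] ->.
  by exists (reqpos_of p.1, reqpos_of p.2); rewrite // mem_filter pn.
rewrite mem_filter => /andP[pn pF] ->; have /andP[lt1 lt2] := F_lt p pF.
exists ((Ordinal lt1, p.1.2), (Ordinal lt2, p.2.2)); rewrite ?inE !endpointE /reqpos_of /=.
  by rewrite -!surjective_pairing pF pn.
by rewrite -!surjective_pairing.
Qed.

Lemma buys_rents k : (k < size r)%N ->
  (buys (@rent_or_buy R) M d (take k.+1 r), rents (@rent_or_buy R) M d (take k.+1 r)) =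
  if M < 1 then (edge_set pt (tree (st k.+1) ++ rented (st k.+1)), set0)
  else (edge_set pt (tree (st k.+1)), edge_set pt (rented (st k.+1))).
Proof.
move=> kr; set s := take k.+1 r; have sk : size s = k.+1 by rewrite size_takel.
have AE : rent_or_buy M (submetric d s) =
    if M < 1 then (select (size s) (tree (st k.+1) ++ rented (st k.+1)), set0)
    else (select (size s) (tree (st k.+1)), select (size s) (rented (st k.+1))).
  by rewrite /rent_or_buy run_submetric -/s sk.
have lt_st e : e \in tree (st k.+1) ++ rented (st k.+1) ->
    (e.1.1 < size s)%N && (e.2.1 < size s)%N.
  by rewrite sk; apply: (run_lt d_metric).
rewrite /buys /rents AE; case: ifP => _ /=; rewrite !edges_at_select //.
- congr pair; rewrite /edges_at; apply/setP => e; rewrite inE.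
  by apply/imsetP => -[p]; rewrite !inE.
- by move=> e eF; apply: lt_st; rewrite mem_cat eF orbT.
- by move=> e eF; apply: lt_st; rewrite mem_cat eF.
Qed.

Lemma buys_sub_bought (A : online_algorithm R) k : (k < size r)%N ->
  buys A M d (take k.+1 r) \subset bought A M d (take k.+1 r).
Proof.
move=> kr; have sk : size (take k.+1 r) = k.+1 by rewrite size_takel.
have lt_k : (k < size (take k.+1 r))%N by rewrite sk.
by rewrite /bought (bigcup_max (Ordinal lt_k)) //= take_takel.
Qed.

Lemma rent_or_buy_serves (i : 'I_(size r)) :
  connects (bought (@rent_or_buy R) M d (take i.+1 r)
            :|: rents (@rent_or_buy R) M d (take i.+1 r))
    (tnth (in_tuple r) i).1 (tnth (in_tuple r) i).2.
Proof.
have ir := ltn_ord i.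
have := run_connects pt theta d_metric i; rewrite /request_pos /= (tnth_nth (x0, x0)) /=.
apply: connects_sub; apply: subset_trans (setSU _ (buys_sub_bought _ ir)).
have := buys_rents ir; case: ifP => _ [-> ->] //.
rewrite setU0 subUset; apply/andP; split; apply: edge_set_sub => e eF; rewrite mem_cat eF //.
by rewrite orbT.
Qed.

Lemma total_length_sub (F1 F2 : {set {set V}}) :
  F1 \subset F2 -> total_length d F1 <= total_length d F2.
Proof.
move=> sF; rewrite /total_length [leLHS]big_mkcond [leRHS]big_mkcond.
apply: ler_sum => e _; case: ifP => [/(subsetP sF)->//|_].
by case: ifP => // _; apply: edge_length_ge0.
Qed.

(** For [1 <= M] the prefactor is 1 and the buying price is [M]. For [M < 1] the rented edges are
    bought as well, so everything costs [M] per unit length. *)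
Lemma rent_or_buy_cost : 0 <= M -> online_cost (@rent_or_buy R) M d r <=
  Num.min 1 M * (theta * seq_length d pt (tree (st (size r)))
                 + \sum_(i < size r) seq_length d pt (rented (st i.+1))).
Proof.
move=> M0; rewrite /online_cost /cost /online_solution /=.
have le_len (F : {set {set V}}) F' : F \subset edge_set pt F' ->
    total_length d F <= seq_length d pt F'.
  by move=> sF; apply: le_trans (total_length_sub sF) (total_length_edge_set _ d_metric _).
have buysE (i : 'I_(size r)) := buys_rents (ltn_ord i).
have tree_sub (i : 'I_(size r)) : {subset tree (st i.+1) <= tree (st (size r))}.
  exact: run_tree_sub.
under eq_bigr do rewrite ffunE.
case M1: (M < 1) buysE => buysE; last first.
  have {}M1 : 1 <= M by rewrite leNgt M1.
  rewrite (min_idPl M1) mul1r [X in _ <= X * _ + _](max_idPr M1) lerD //.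
    rewrite ler_wpM2l //; apply: le_len; apply/bigcupsP => i _.
    by case: (buysE i) => -> _; apply: edge_set_sub; apply: tree_sub.
  by apply: ler_sum => i _; case: (buysE i) => _ ->; apply: le_len.
rewrite (min_idPr (ltW M1)) [X in _ * (X * _ + _)](max_idPl (ltW M1)) mul1r.
rewrite [X in _ + X <= _]big1 => [|i _]; last first.
  by case: (buysE i) => _ ->; rewrite /total_length big_set0.
rewrite addr0 ler_wpM2l //.
set Q := flatten [seq rented (st i.+1) | i : 'I_(size r)].
have -> : \sum_(i < size r) seq_length d pt (rented (st i.+1)) = seq_length d pt Q.
  by rewrite /seq_length big_flatten big_map big_enum.
rewrite -big_cat; apply: le_len; apply/bigcupsP => i _.
case: (buysE i) => -> _; apply: edge_set_sub => e; rewrite !mem_cat.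
case/orP=> [/tree_sub -> //|eQ]; apply/orP; right; apply/flatten_mapP.
by exists i; rewrite ?mem_enum.
Qed.

Lemma rent_or_buy_le_OPT : 0 <= M ->
  online_cost (@rent_or_buy R) M d r <=
  224 * (\sum_(i < #|terminals r|) i.+1%:R^-1) * OPT M d r.
Proof.
move=> M0; apply: le_trans (rent_or_buy_cost M0) _.
have [[H Q] /and3P[/= H_edges /forallP Q_edges /forallP HQ] ->] := OPT_attained M d r.
have th1 : 1 <= theta by rewrite le_max lexx.
have T_pt (i : 'I_(size r)) b : pt (val i, b) \in terminals r.
  have i_r : nth (x0, x0) r i \in r by rewrite mem_nth.
  by rewrite /request_pos inE mem_cat; case: b; rewrite map_f ?orbT.
have HQ' (i : 'I_(size r)) : connects (H :|: Q i) (pt (val i, false)) (pt (val i, true)).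
  by move: (HQ i); rewrite (tnth_nth (x0, x0)).
have alg := run_cost pt d_metric d_ge1 th1 (size r).
have charge := charge_le d_metric d_ge1 th1 T_pt H_edges Q_edges HQ'.
rewrite sum_weight -!/(total_length d _) in charge.
rewrite /cost /=; set hk := \sum_(_ < #|_|) _ in charge *.
have hk0 : 0 <= hk by apply: sumr_ge0 => i _; rewrite invr_ge0.
set X := (X in _ * X <= _); set A := \sum_(_ < _ | _) _ in alg charge.
set cQ := \sum_i _ in charge *.
have cQ0 : 0 <= cQ by apply: sumr_ge0 => i _; apply: total_length_ge0.
have mu0 : 0 <= Num.min 1 M by rewrite le_min ler01.
(* The constant is [7 * 32], from [run_cost] and [charge_le]. *)
have le_X : X <= 224 * hk * (theta * total_length d H + cQ).
  by apply: le_trans alg _; move: charge; rewrite -/A -!mulrA; lra.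
apply: le_trans (ler_wpM2l mu0 le_X) _; rewrite mulrCA ler_wpM2l ?mulr_ge0 //.
(* The product of [Num.min 1 M] and [Num.max 1 M] is [M], which restores the true buying price; the
   rent is only scaled down. *)
rewrite mulrDr mulrA lerD //; last by rewrite ler_piMl // ge_min lexx.
by case: (leP 1 M) => _; rewrite ?mul1r ?mulr1.
Qed.

End Bridge.

Theorem theorem1p2 (R : realType) :
  exists A : online_algorithm R,
    rent_or_buy_algorithm A /\ O_log_competitive A.
Proof.
exists (@rent_or_buy R); split=> [V d M r d_metric [d_ge1 _] _ i|].
  exact: (rent_or_buy_serves M (tnth (in_tuple r) i).1).
(* The constant is [224 * 3]: for at least two terminals [ln k >= ln 2 >= 1 / 2], so
   [1 + ln k <= 3 * ln k]. *)
exists 672 => V d M r d_metric [d_ge1 [x0 _]] M0 k2.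
apply: le_trans (rent_or_buy_le_OPT x0 r d_metric d_ge1 M0) _.
have OPT0 : 0 <= OPT M d r.
  have [S _ ->] := OPT_attained M d r.
  rewrite addr_ge0 ?mulr_ge0 ?total_length_ge0 // sumr_ge0 // => i _.
  exact: total_length_ge0.
rewrite ler_wpM2r //; case: #|_| k2 => // k k2.
have := harmonic_le_ln R k; have := ln2_ge R.
have : ln 2 <= ln k.+1%:R :> R by rewrite ler_ln ?posrE ?ltr0n // ler_nat.
by lra.
Qed.
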